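(* Let $\mathcal{G}$ be a nonlocal game and $K>0$. There exist constants $C>0$, $\epsilon_0>0$ depending only on $\mathcal G$ and $K$ such that for every $0\le\epsilon\le\epsilon_0$ and every $d\ge1$: \begin{enumerate} \item If $\mathcal G$ is a synchronous game and $\phi$ is an $\epsilon$-representation of $\mathcal A(\mathcal G)$ on $\mathbb C^d$ with respect to $\|\cdot\|_f$ with $\|\phi(p^i_a)\|_{op}\le K$ for all $(i,a)$, then there is a synchronous strategy for $\mathcal G$ using the maximally entangled state on $\mathbb C^d\otimes\mathbb C^d$, with Bob's projections $Q^i_a$ satisfying $\|Q^i_a-\phi(p^i_a)\|_f\le C\epsilon$ for all $(i,a)$, whose winning probability is at least $1-C\epsilon^2$. \item If $\mathcal G$ is a BCS game and $\phi$ is an $\epsilon$-representation of $\mathcal B(\mathcal G)$ on $\mathbb C^d$ with respect to $\|\cdot\|_f$ with $\|\phi(x_j)\|_{op}\le K$ for all $j$, then there is a quantum strategy for $\mathcal G$ using the maximally entangled state on $\mathbb C^d\otimes\mathbb C^d$, with Bob's observables $X_j$ satisfying $\|X_j-\phi(x_j)\|_f\le C\epsilon$ for all $j$, whose winning probability is at least $1-C\epsilon^2$. \item If $\mathcal G$ is an XOR game whose marginal row biases are all non-zero, and $\phi$ is an $\epsilon$-representation of $\mathcal C(\mathcal G)$ on $\mathbb C^d$ with respect to $\|\cdot\|_f$ with $\|\phi(s_j)\|_{op}\le K$ for all $j$, then there is a quantum strategy for $\mathcal G$ using the maximally entangled state on $\mathbb C^d\otimes\mathbb C^d$, with Bob's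 observables $X_j$ satisfying $\|X_j-\phi(s_j)\|_f\le C\epsilon$ for all $j$, whose bias is at least $\beta^*(\mathcal G)-C\epsilon$. \end{enumerate}
   Context: Norms: for an operator $A$ on a finite-dimensional Hilbert space of dimension $d$, $\|A\|_{op}$ is the operator norm, $\|A\|_F=\mathrm{tr}(A^*A)^{1/2}$ the Frobenius norm and $\|A\|_f=\|A\|_F/\sqrt d$ the little Frobenius norm. Finitely presented algebras: $\mathbb{C}^*\langle S:R\rangle$ is the quotient of the free unital complex $*$-algebra $\mathbb{C}^*\langle S\rangle$ on a finite set $S$ by the two-sided $*$-ideal generated by a finite set $R$; a relation written $a=b$ stands for $a-b\in R$. Given a (semi)norm $\|\cdot\|$ on operators on $H$, an $\epsilon$-representation is a unital $*$-homomorphism $\phi:\mathbb{C}^*\langle S\rangle\to\mathcal L(H)$ (determined by the $\phi(s)$, $s\in S$) with $\|\phi(r)\|\le\epsilon$ for all $r\in R$. Nonlocal games and strategies: a game $\mathcal{G}=(\eta,I,J,A,B,V)$ has finite input sets $I,J$, output sets $A,B$, a probability distribution $\eta$ on $I\times J$ and a predicate $V:A\times B\times I\times J\to\{0,1\}$. A quantum strategy consists of a finite-dimensional Hilbert space $H$, projection-valued measures $\{E^i_a\}_{a}$ for Alice and $\{F^j_b\}_b$ for Bob on $H$, and a unit vector $|\psi\rangle\in H\otimes H$; its winning probability is $\sum_{i,j}\eta(i,j)\sum_{a,b}V(a,b|i,j)\langle\psi|E^i_a\otimes F^j_b|\psi\rangle$. The maximally entangled state on $\mathbb C^d\otimes\mathbb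 C^d$ is $d^{-1/2}\sum_t|t\rangle\otimes|t\rangle$ for an orthonormal basis $\{|t\rangle\}$; $\overline X$ denotes entrywise complex conjugation in this basis. Synchronous games: $I=J$, $A=B$, $V(a,b|i,i)=0$ whenever $a\ne b$, $\eta(i,j)>0$ for all $i,j$. A synchronous strategy is one with $E^i_a=\overline{F^i_a}$. The synchronous algebra $\mathcal A(\mathcal G)$ has generators $p^i_a$ and relations $(p^i_a)^2=p^i_a=(p^i_a)^*$, $\sum_{a}p^i_a=1$ for each $i$, and $p^i_ap^j_b=0$ whenever $V(a,b|i,j)=0$. BCS games: variables $x_1,\dots,x_n$, constraints $C_1,\dots,C_m$ with scopes $K_i$, each encoded by the unique real multilinear polynomial $f_i=\sum_{\alpha\subseteq K_i}\hat f^{(i)}_\alpha x^\alpha$ (products in increasing order of index) equal to $-1$ exactly on satisfying assignments in $\{\pm1\}^{K_i}$ and $1$ otherwise. Alice gets $i$, answers a satisfying assignment of $K_i$; Bob gets $j$, answers a value in $\{\pm1\}$; inputs are drawn from $\eta$; they win iff $x_j\notin K_i$ or their values for $x_j$ agree. A quantum strategy consists of, for each $i$, pairwise commuting self-adjoint unitaries $Y_{ij}$ ($x_j\in K_i$) with $f_i(Y_{ij}:x_j\in K_i)=-\mathbb 1$, Bob's self-adjoint unitaries $X_j$, and a state $|\psi\rangle$; winning probability $\sum_{i,j}\eta(i,j)p_{ij}$ with $p_{ij}=1$ if $x_j\notin K_i$ and $p_{ij}=\frac12(1+\langle\psi|Y_{ij}\otimes X_j|\psi\rangle)$ otherwise.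 The BCS algebra $\mathcal B(\mathcal G)$ has generators $x_1,\dots,x_n$ and relations $x_j^*=x_j$, $x_j^2=1$, $f_i(K_i)=-1$, and $x_jx_{j'}=x_{j'}x_j$ whenever $x_j,x_{j'}\in K_i$ for some $i$. XOR games: an $m\times n$ $(0,1)$-matrix $(t_{ij})$ and distribution $\pi$; cost matrix $g_{ij}=(-1)^{t_{ij}}\pi(i,j)$. A strategy consists of self-adjoint unitaries $Y_1,\dots,Y_m$ (Alice), $X_1,\dots,X_n$ (Bob) and a state $|\psi\rangle$; bias $\beta=\sum_{i,j}g_{ij}\langle\psi|Y_i\otimes X_j|\psi\rangle$, optimal bias $\beta^*(\mathcal G)$ is the supremum. The marginal row biases are the real constants $c_i$ such that every optimal strategy satisfies $\sum_j g_{ij}(\mathbb 1\otimes X_j)|\psi\rangle=c_i(Y_i\otimes\mathbb 1)|\psi\rangle$ and $c_i=\sum_jg_{ij}\langle\psi|Y_i\otimes X_j|\psi\rangle$; thus $\sum_ic_i=\beta^*$. The solution algebra $\mathcal C(\mathcal G)$ has generators $s_1,\dots,s_n$ and relations $s_j=s_j^*$, $s_j^2=1$, $(\sum_jg_{ij}s_j)^2=c_i^2$ for all $i$. *)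

(* Defs.v *)
From HB Require Import structures.
From mathcomp Require Import all_boot all_order all_algebra.
From mathcomp Require Import classical_sets reals.
From mathcomp Require Import complex mxtens.

Set Implicit Arguments.
Unset Strict Implicit.
Unset Printing Implicit Defensive.

Import Order.TTheory GRing.Theory Num.Theory.
Local Open Scope ring_scope.
Local Open Scope complex_scope.

Section Defs.
Context {R : realType}.
Local Notation C := (R[i]).

Definition entconjmx {m n} (A : 'M[C]_(m, n)) : 'M[C]_(m, n) := map_mx (@conjc R) A.
Definition adjmx {m n} (A : 'M[C]_(m, n)) : 'M[C]_(n, m) := (entconjmx A)^T.

Definition vnorm {n} (v : 'cV[C]_n) : R :=
  Num.sqrt (complex.Re ((adjmx v *m v) 0 0)).

Definition opnorm {n} (A : 'M[C]_n) : R :=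
  sup (fun r : R => exists v : 'cV[C]_n, vnorm v = 1 /\ r = vnorm (A *m v)).

Definition frobnorm {n} (A : 'M[C]_n) : R :=
  Num.sqrt (complex.Re (\tr (adjmx A *m A))).
Definition fnorm {n} (A : 'M[C]_n) : R := frobnorm A / Num.sqrt (n%:R).

Definition is_proj {n} (P : 'M[C]_n) : Prop := P *m P = P /\ adjmx P = P.
Definition is_pvm {n} {A : finType} (E : A -> 'M[C]_n) : Prop :=
  (forall a, is_proj (E a)) /\ \sum_a E a = 1%:M.
Definition is_sa_unitary {n} (X : 'M[C]_n) : Prop :=
  adjmx X = X /\ adjmx X *m X = 1%:M /\ X *m adjmx X = 1%:M.

Definition braket {N} (psi : 'cV[C]_N) (M : 'M[C]_N) : C := (adjmx psi *m M *m psi) 0 0.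

Definition maxent (d : nat) : 'cV[C]_(d * d) :=
  ((Num.sqrt (d%:R : R))^-1)%:C *:
    \sum_(t < d) tensmx (delta_mx t 0 : 'cV[C]_d) (delta_mx t 0 : 'cV[C]_d).

(* terms of the free unital complex *-algebra C*<S> *)
Inductive sterm (S : Type) : Type :=
| sgen of S
| sone
| sscal of C & sterm S
| sadd of sterm S & sterm S
| smul of sterm S & sterm S
| sstar of sterm S.

Definition szero {S} : sterm S := sscal 0 (sone S).
Definition ssub {S} (a b : sterm S) : sterm S := sadd a (sscal (-1) b).
Definition sbig {S T} (s : seq T) (f : T -> sterm S) : sterm S :=
  foldr (fun x acc => sadd (f x) acc) szero s.
Definition sprodl {S T} (s : seq T) (f : T -> sterm S) : sterm S :=
  foldr (fun x acc => smul (f x) acc) (sone S) s.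

Fixpoint seval {S} {d} (phi : S -> 'M[C]_d) (t : sterm S) : 'M[C]_d :=
  match t with
  | sgen s => phi s
  | sone => 1%:M
  | sscal c u => c *: seval phi u
  | sadd u v => seval phi u + seval phi v
  | smul u v => seval phi u *m seval phi v
  | sstar u => adjmx (seval phi u)
  end.

Definition eps_rep {S} {d} (rels : sterm S -> Prop) (nrm : 'M[C]_d -> R)
  (phi : S -> 'M[C]_d) (eps : R) : Prop :=
  forall r, rels r -> nrm (seval phi r) <= eps.

Definition is_distr {I J : finType} (eta : I -> J -> R) : Prop :=
  (forall i j, 0 <= eta i j) /\ \sum_i \sum_j eta i j = 1.

Definition win_prob {I J A B : finType} {n} (eta : I -> J -> R)
  (V : A -> B -> I -> J -> bool) (E : I -> A -> 'M[C]_n) (F : J -> B -> 'M[C]_n)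
  (psi : 'cV[C]_(n * n)) : R :=
  complex.Re (\sum_i \sum_j (eta i j)%:C *
     \sum_a \sum_b (V a b i j)%:R * braket psi (tensmx (E i a) (F j b))).

Definition is_sync_game {I A : finType} (eta : I -> I -> R) (V : A -> A -> I -> I -> bool) : Prop :=
  is_distr eta /\ (forall i j, 0 < eta i j) /\ (forall a b i, a != b -> V a b i i = false).

Inductive sync_rel {I A : finType} (V : A -> A -> I -> I -> bool) : sterm (I * A)%type -> Prop :=
| sync_idem i a : sync_rel V (ssub (smul (sgen (i, a)) (sgen (i, a))) (sgen (i, a)))
| sync_sa i a : sync_rel V (ssub (sgen (i, a)) (sstar (sgen (i, a))))
| sync_sum i : sync_rel V (ssub (sbig (enum A) (fun a => sgen (i, a))) (sone _))
| sync_orth i j a b : V a b i j = false -> sync_rel V (smul (sgen (i, a)) (sgen (j, b))).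

(* variables 'I_n, constraints 'I_m with scopes K i; an assignment of K i is a
   {ffun 'I_n -> bool} vanishing outside K i, with b = true meaning the value -1;
   sat i x says that the assignment x of K i satisfies constraint C_i. *)

Definition sgnb (b : bool) : R := if b then -1 else 1.

Definition assign_of {n} (K : {set 'I_n}) (x : {ffun 'I_n -> bool}) : bool :=
  [forall j, (j \notin K) ==> ~~ x j].

(* coefficients of the unique multilinear polynomial f_i equal to -1 on satisfying
   assignments and 1 otherwise (Fourier inversion on {+-1}^{K_i}) *)
Definition bcs_fhat {n m} (K : 'I_m -> {set 'I_n}) (sat : 'I_m -> {ffun 'I_n -> bool} -> bool)
  (i : 'I_m) (al : {set 'I_n}) : R :=
  (2 ^+ #|K i|)^-1 * \sum_(x | assign_of (K i) x)
      (if sat i x then -1 else 1) * \prod_(j in al) sgnb (x j).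

Definition bcs_fterm {n m} (K : 'I_m -> {set 'I_n}) (sat : 'I_m -> {ffun 'I_n -> bool} -> bool)
  (i : 'I_m) : sterm 'I_n :=
  sbig [seq al : {set 'I_n} <- enum {set 'I_n} | al \subset K i]
    (fun al : {set 'I_n} => sscal (bcs_fhat K sat i al)%:C
                 (sprodl [seq j <- enum 'I_n | j \in al] (@sgen _))).

Inductive bcs_rel {n m} (K : 'I_m -> {set 'I_n}) (sat : 'I_m -> {ffun 'I_n -> bool} -> bool)
  : sterm 'I_n -> Prop :=
| bcs_sa j : bcs_rel K sat (ssub (sstar (sgen j)) (sgen j))
| bcs_sq j : bcs_rel K sat (ssub (smul (sgen j) (sgen j)) (sone _))
| bcs_f i : bcs_rel K sat (ssub (bcs_fterm K sat i) (sscal (-1) (sone _)))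
| bcs_comm i j j' : j \in K i -> j' \in K i ->
    bcs_rel K sat (ssub (smul (sgen j) (sgen j')) (smul (sgen j') (sgen j))).

Definition is_bcs_strategy {n m k} (K : 'I_m -> {set 'I_n})
  (sat : 'I_m -> {ffun 'I_n -> bool} -> bool)
  (Y : 'I_m -> 'I_n -> 'M[C]_k) (X : 'I_n -> 'M[C]_k) (psi : 'cV[C]_(k * k)) : Prop :=
  (forall i j, j \in K i -> is_sa_unitary (Y i j)) /\
  (forall i j j', j \in K i -> j' \in K i -> Y i j *m Y i j' = Y i j' *m Y i j) /\
  (forall i, seval (Y i) (bcs_fterm K sat i) = - 1%:M) /\
  (forall j, is_sa_unitary (X j)) /\
  vnorm psi = 1.

Definition bcs_win_prob {n m k} (eta : 'I_m -> 'I_n -> R) (K : 'I_m -> {set 'I_n})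
  (Y : 'I_m -> 'I_n -> 'M[C]_k) (X : 'I_n -> 'M[C]_k) (psi : 'cV[C]_(k * k)) : R :=
  \sum_i \sum_j eta i j *
    (if j \in K i then (1 + complex.Re (braket psi (tensmx (Y i j) (X j)))) / 2 else 1).

Definition xor_cost {m n} (t : 'I_m -> 'I_n -> bool) (pi : 'I_m -> 'I_n -> R) i j : R :=
  sgnb (t i j) * pi i j.

Definition is_xor_strategy {m n k} (Y : 'I_m -> 'M[C]_k) (X : 'I_n -> 'M[C]_k)
  (psi : 'cV[C]_(k * k)) : Prop :=
  (forall i, is_sa_unitary (Y i)) /\ (forall j, is_sa_unitary (X j)) /\ vnorm psi = 1.

Definition xor_bias {m n k} (g : 'I_m -> 'I_n -> R) (Y : 'I_m -> 'M[C]_k)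
  (X : 'I_n -> 'M[C]_k) (psi : 'cV[C]_(k * k)) : R :=
  complex.Re (\sum_i \sum_j (g i j)%:C * braket psi (tensmx (Y i) (X j))).

Definition xor_opt_bias {m n} (g : 'I_m -> 'I_n -> R) : R :=
  sup (fun b : R => exists k (Y : 'I_m -> 'M[C]_k) (X : 'I_n -> 'M[C]_k) psi,
         is_xor_strategy Y X psi /\ b = xor_bias g Y X psi).

Definition is_marginal_row_biases {m n} (g : 'I_m -> 'I_n -> R) (c : 'I_m -> R) : Prop :=
  forall k (Y : 'I_m -> 'M[C]_k) (X : 'I_n -> 'M[C]_k) psi,
    is_xor_strategy Y X psi -> xor_bias g Y X psi = xor_opt_bias g ->
    forall i,
      \sum_j (g i j)%:C *: (tensmx (1%:M : 'M[C]_k) (X j) *m psi)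
        = (c i)%:C *: (tensmx (Y i) (1%:M : 'M[C]_k) *m psi)
      /\ (c i)%:C = \sum_j (g i j)%:C * braket psi (tensmx (Y i) (X j)).

Inductive xor_rel {m n} (g : 'I_m -> 'I_n -> R) (c : 'I_m -> R) : sterm 'I_n -> Prop :=
| xor_sa j : xor_rel g c (ssub (sgen j) (sstar (sgen j)))
| xor_sq j : xor_rel g c (ssub (smul (sgen j) (sgen j)) (sone _))
| xor_row i : xor_rel g c
    (ssub (smul (sbig (enum 'I_n) (fun j => sscal (g i j)%:C (sgen j)))
                (sbig (enum 'I_n) (fun j => sscal (g i j)%:C (sgen j))))
          (sscal ((c i) ^+ 2)%:C (sone _))).

End Defs.

(* Main.v *)
(* Rounding one almost representation. If X is almost a self-adjoint involution,
   the sign of its Hermitian part H is a self-adjoint unitary, and it is close to X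
   because |sgn x - x| <= |x^2 - 1| for real x. If P_a (a in A) is almost a
   projection-valued measure, label the outcomes by distinct integers l_a and take
   the spectral projections Q_a of sum_a l_a P_a around the l_a: from
   (H - l_a) P_a ~ 0 one gets Q_b P_a ~ 0 for b <> a, hence Q_a ~ P_a. All estimates
   are linear in the defect, with constants that do not depend on the dimension.

   Synchronous and BCS games. For the maximally entangled state,
   <psi| conj(Q) (x) Q' |psi> = tr(Q^* Q') / d. A losing pair of projections
   contributes |Q Q'|_f^2, which is quadratic in the defect; so is the loss
   1 - tr(Y X) / d = |Y - X|_f^2 / 2 for self-adjoint unitaries. For a BCS
   constraint, Alice rounds the joint projections prod_j (1 + x_j X_j) / 2 indexed by
   the satisfying assignments x of the constraint.

   XOR games. Alice plays the sign of (1/c_i) sum_j g_ij X_j, which gives bias at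
   least sum_i c_i - O(eps). That sum_i c_i is the optimal bias needs an optimal
   strategy to exist: the bias is a linear function of a Gram matrix, hence attains
   its maximum on the compact set of positive semidefinite matrices with unit
   diagonal, and Clifford generators turn Gram vectors back into a strategy
   (Tsirelson). *)
Require Import Defs.
From HB Require Import structures.
From mathcomp Require Import all_boot all_order all_algebra.
From mathcomp Require Import classical_sets reals.
From mathcomp Require Import complex mxtens spectral sesquilinear.
From mathcomp Require Import ring lra.
Import Order.TTheory GRing.Theory Num.Theory.
Local Open Scope ring_scope.

Set Implicit Arguments.
Unset Strict Implicit.
Unset Printing Implicit Defensive.
Local Open Scope complex_scope.

(** * The Hilbert-Schmidt inner product *)

Section HilbertSchmidt.
Context {R : realType}.
Local Notation C := (R[i]).
Local Notation Re := (@complex.Re R).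

Lemma ReD (x y : C) : Re (x + y) = Re x + Re y.
Proof. by case: x y => [a b] [c e]. Qed.

Lemma ReN (x : C) : Re (- x) = - Re x.
Proof. by case: x. Qed.

Lemma Re_sum (I : Type) (s : seq I) (P : pred I) (F : I -> C) :
  Re (\sum_(i <- s | P i) F i) = \sum_(i <- s | P i) Re (F i).
Proof. exact: (big_morph Re ReD). Qed.

Lemma Re_scale (k : R) (x : C) : Re (k%:C * x) = k * Re x.
Proof. by case: x => a b /=; rewrite mul0r subr0. Qed.

Lemma adjmxE m n (A : 'M[C]_(m, n)) i j : adjmx A i j = conjc (A j i).
Proof. by rewrite !mxE. Qed.

Lemma adjmxK m n (A : 'M[C]_(m, n)) : adjmx (adjmx A) = A.
Proof. by apply/matrixP=> i j; rewrite !adjmxE conjcK. Qed.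

Lemma adjmxM m n p (A : 'M[C]_(m, n)) (B : 'M[C]_(n, p)) :
  adjmx (A *m B) = adjmx B *m adjmx A.
Proof. by rewrite /adjmx /entconjmx map_mxM trmx_mul. Qed.

Lemma adjmxD m n (A B : 'M[C]_(m, n)) : adjmx (A + B) = adjmx A + adjmx B.
Proof. by rewrite /adjmx /entconjmx map_mxD linearD. Qed.

Lemma adjmx0 m n : adjmx (0 : 'M[C]_(m, n)) = 0.
Proof. by rewrite /adjmx /entconjmx map_mx0 trmx0. Qed.

Lemma adjmxZ m n (k : R) (A : 'M[C]_(m, n)) : adjmx (k%:C *: A) = k%:C *: adjmx A.
Proof. by apply/matrixP=> i j; rewrite !mxE rmorphM /= oppr0. Qed.

Lemma adjmxN m n (A : 'M[C]_(m, n)) : adjmx (- A) = - adjmx A.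
Proof. by rewrite /adjmx /entconjmx map_mxN linearN. Qed.

Lemma adjmxB m n (A B : 'M[C]_(m, n)) : adjmx (A - B) = adjmx A - adjmx B.
Proof. by rewrite adjmxD adjmxN. Qed.

Lemma adjmx1 n : adjmx (1%:M : 'M[C]_n) = 1%:M.
Proof. by rewrite /adjmx /entconjmx map_mx1 trmx1. Qed.

Lemma adjmx_sum m n (I : Type) (s : seq I) (P : pred I) (F : I -> 'M[C]_(m, n)) :
  adjmx (\sum_(i <- s | P i) F i) = \sum_(i <- s | P i) adjmx (F i).
Proof. exact: (big_morph _ (@adjmxD m n) (adjmx0 m n)). Qed.

(** The real part makes this a real inner product, symmetric and bilinear over [R]; rectangular
    shapes let it serve column vectors too. *)
Definition hsip {m n} (A B : 'M[C]_(m, n)) : R := Re (\tr (adjmx A *m B)).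
Definition hsnorm {m n} (A : 'M[C]_(m, n)) : R := Num.sqrt (hsip A A).

Lemma hsipE m n (A B : 'M[C]_(m, n)) :
  hsip A B = \sum_i \sum_j Re (conjc (A i j) * B i j).
Proof.
rewrite /hsip /mxtrace Re_sum exchange_big /=; apply: eq_bigr => j _.
by rewrite mxE Re_sum; apply: eq_bigr => i _; rewrite adjmxE.
Qed.

Lemma hsip_sym m n (A B : 'M[C]_(m, n)) : hsip A B = hsip B A.
Proof.
rewrite !hsipE; apply: eq_bigr => i _; apply: eq_bigr => j _.
by case: (A i j) (B i j) => [a b] [c e] /=; ring.
Qed.

Lemma hsipDr m n (A B B' : 'M[C]_(m, n)) : hsip A (B + B') = hsip A B + hsip A B'.
Proof. by rewrite /hsip mulmxDr linearD ReD. Qed.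

Lemma hsipDl m n (A A' B : 'M[C]_(m, n)) : hsip (A + A') B = hsip A B + hsip A' B.
Proof. by rewrite hsip_sym hsipDr !(hsip_sym B). Qed.

Lemma hsipZr m n k (A B : 'M[C]_(m, n)) : hsip A (k%:C *: B) = k * hsip A B.
Proof. by rewrite /hsip -scalemxAr linearZ Re_scale. Qed.

Lemma hsipZl m n k (A B : 'M[C]_(m, n)) : hsip (k%:C *: A) B = k * hsip A B.
Proof. by rewrite hsip_sym hsipZr hsip_sym. Qed.

Lemma hsipNr m n (A B : 'M[C]_(m, n)) : hsip A (- B) = - hsip A B.
Proof. by rewrite /hsip mulmxN linearN ReN. Qed.

Lemma hsipNl m n (A B : 'M[C]_(m, n)) : hsip (- A) B = - hsip A B.
Proof. by rewrite hsip_sym hsipNr hsip_sym. Qed.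

Lemma hsip_suml m n (I : Type) (s : seq I) (P : pred I) (F : I -> 'M[C]_(m, n)) B :
  hsip (\sum_(i <- s | P i) F i) B = \sum_(i <- s | P i) hsip (F i) B.
Proof.
apply: (big_morph (fun A => hsip A B)) => [A A'|]; first exact: hsipDl.
by rewrite /hsip adjmx0 mul0mx linear0.
Qed.

Lemma hsip_sumr m n (I : Type) (s : seq I) (P : pred I) (F : I -> 'M[C]_(m, n)) B :
  hsip B (\sum_(i <- s | P i) F i) = \sum_(i <- s | P i) hsip B (F i).
Proof. by rewrite hsip_sym hsip_suml; apply: eq_bigr => i _; exact: hsip_sym. Qed.

Lemma hsip_ge0 m n (A : 'M[C]_(m, n)) : 0 <= hsip A A.
Proof.
rewrite hsipE; apply: sumr_ge0 => i _; apply: sumr_ge0 => j _.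
by case: (A i j) => a b /=; nra.
Qed.

Lemma hsip_mull m n p (X : 'M[C]_(m, n)) (A : 'M[C]_(n, p)) B :
  hsip (X *m A) B = hsip A (adjmx X *m B).
Proof. by rewrite /hsip adjmxM mulmxA. Qed.

Lemma hsip_adj m n (A B : 'M[C]_(m, n)) : hsip (adjmx A) (adjmx B) = hsip A B.
Proof.
rewrite !hsipE exchange_big; apply: eq_bigr => i _; apply: eq_bigr => j _.
by rewrite !adjmxE; case: (A i j) (B i j) => [a b] [c e] /=; ring.
Qed.

Lemma hsip_mulr m n p (X : 'M[C]_(n, p)) (A : 'M[C]_(m, n)) B :
  hsip (A *m X) B = hsip A (B *m adjmx X).
Proof. by rewrite -hsip_adj adjmxM hsip_mull -adjmxM hsip_adj. Qed.

Lemma hsnorm_ge0 m n (A : 'M[C]_(m, n)) : 0 <= hsnorm A.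
Proof. exact: sqrtr_ge0. Qed.

Lemma hsnorm_sqr m n (A : 'M[C]_(m, n)) : hsnorm A ^+ 2 = hsip A A.
Proof. by rewrite sqr_sqrtr // hsip_ge0. Qed.

(** For [b > 0] the choice [s = b], [t = - h] gives [b * (a * b - h ^+ 2) >= 0]; for [b = 0] the
    choice [s = h], [t = - (a + 1)] forces [h = 0]. *)
Lemma quadratic_discriminant (a b h : R) :
  (forall s t : R, 0 <= s ^+ 2 * a + 2 * s * t * h + t ^+ 2 * b) ->
  h ^+ 2 <= a * b.
Proof.
move=> q; have a0 : 0 <= a by have := q 1 0; nra.
have b0 : 0 <= b by have := q 0 1; nra.
have [bE|bN] := eqVneq b 0; first by have := q h (- (a + 1)); rewrite bE; nra.
have bp : 0 < b by rewrite lt_def bN.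
by rewrite -subr_ge0 -(pmulr_rge0 _ bp); have := q b (- h); nra.
Qed.

Lemma hsip_cs_sqr m n (A B : 'M[C]_(m, n)) : hsip A B ^+ 2 <= hsip A A * hsip B B.
Proof.
apply: quadratic_discriminant => s t; have := hsip_ge0 (s%:C *: A + t%:C *: B).
rewrite !(hsipDl, hsipDr, hsipZl, hsipZr) (hsip_sym B A).
by move: (hsip A A) (hsip A B) (hsip B B) => a h b; nra.
Qed.

Lemma hsip_cs m n (A B : 'M[C]_(m, n)) : hsip A B <= hsnorm A * hsnorm B.
Proof.
have h : `|hsip A B| ^+ 2 <= (hsnorm A * hsnorm B) ^+ 2.
  by rewrite exprMn !hsnorm_sqr real_normK ?num_real // hsip_cs_sqr.
apply: (le_trans (ler_norm _)); move: h.
by rewrite ler_pXn2r // ?nnegrE // mulr_ge0 // hsnorm_ge0.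
Qed.

Lemma hsnorm_le_sqr m n p q (A : 'M[C]_(m, n)) (B : 'M[C]_(p, q)) K :
  0 <= K -> hsip A A <= K ^+ 2 * hsip B B -> hsnorm A <= K * hsnorm B.
Proof.
move=> K0; rewrite -!hsnorm_sqr -exprMn.
by rewrite ler_pXn2r // ?nnegrE ?mulr_ge0 // hsnorm_ge0.
Qed.

Lemma hsnormD m n (A B : 'M[C]_(m, n)) : hsnorm (A + B) <= hsnorm A + hsnorm B.
Proof.
have := hsip_cs A B; have := hsnorm_ge0 A; have := hsnorm_ge0 B.
have := hsnorm_ge0 (A + B); have : hsnorm (A + B) ^+ 2 =
    hsnorm A ^+ 2 + hsip A B + (hsip A B + hsnorm B ^+ 2).
  by rewrite !hsnorm_sqr !(hsipDl, hsipDr) (hsip_sym B A) !addrA.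
by move: (hsnorm _) (hsnorm _) (hsnorm _) (hsip _ _) => x y z h; nra.
Qed.

Lemma hsnormZ m n k (A : 'M[C]_(m, n)) : hsnorm (k%:C *: A) = `|k| * hsnorm A.
Proof. by rewrite /hsnorm hsipZl hsipZr mulrA -expr2 sqrtrM ?sqr_ge0 // sqrtr_sqr. Qed.

Lemma hsnormN m n (A : 'M[C]_(m, n)) : hsnorm (- A) = hsnorm A.
Proof. by rewrite /hsnorm hsipNl hsipNr opprK. Qed.

Lemma hsnorm_adj m n (A : 'M[C]_(m, n)) : hsnorm (adjmx A) = hsnorm A.
Proof. by rewrite /hsnorm hsip_adj. Qed.

Lemma vnormE n (v : 'cV[C]_n) : vnorm v = hsnorm v.
Proof. by rewrite /hsnorm /hsip /mxtrace big_ord1. Qed.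

Lemma hsip_cV n (u v : 'cV[C]_n) : hsip u v = Re ((adjmx u *m v) 0 0).
Proof. by rewrite /hsip /mxtrace big_ord1. Qed.

Lemma hsip_col m n (A B : 'M[C]_(m, n)) :
  hsip A B = \sum_j hsip (col j A) (col j B).
Proof.
rewrite hsipE exchange_big; apply: eq_bigr => j _.
by rewrite hsipE; apply: eq_bigr => i _; rewrite big_ord1 !mxE.
Qed.

(** Each entry of the product is a row times a column, so Cauchy-Schwarz bounds it by the product of
    their norms; the sum of the squared bounds factors. *)
Lemma hsnormM m n p (A : 'M[C]_(m, n)) (B : 'M[C]_(n, p)) :
  hsnorm (A *m B) <= hsnorm A * hsnorm B.
Proof.
apply: hsnorm_le_sqr (hsnorm_ge0 _) _; rewrite hsnorm_sqr.
have -> : hsip A A * hsip B B = \sum_j \sum_i hsip (row i A) (row i A) * hsip (col j B) (col j B).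
  rewrite (hsip_col B) mulr_sumr; apply: eq_bigr => j _.
  rewrite -mulr_suml -(hsip_adj A A) hsip_col; congr (_ * _); apply: eq_bigr => i _.
  by rewrite -(hsip_adj (row i A)); congr hsip; apply/matrixP => k l; rewrite !mxE.
rewrite hsipE exchange_big; apply: ler_sum => j _; apply: ler_sum => i _.
set a := row i A; set b := col j B.
have ab : (A *m B) i j = \tr (a *m b).
  by rewrite /mxtrace big_ord1 !mxE; apply: eq_bigr => k _; rewrite !mxE.
set x := (A *m B) i j in ab *.
(* Scaling the column by the conjugate of the entry turns the real inner product into the squared
   modulus of [x], so the real Cauchy-Schwarz inequality controls a complex entry. *)
pose z : C := conjc x.
have : hsip (adjmx a) (z *: b) = Re (conjc x * x).
  by rewrite /hsip adjmxK -scalemxAr linearZ /= -ab.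
have h2 : hsip (z *: b) (z *: b) = Re (conjc x * x) * hsip b b.
  rewrite !hsipE mulr_sumr; apply: eq_bigr => k _; rewrite mulr_sumr; apply: eq_bigr => l _.
  by rewrite !mxE /z; case: (x) (B k j) => [u v] [u' v'] /=; ring.
move=> h1; have := hsip_cs_sqr (adjmx a) (z *: b).
rewrite h1 h2 hsip_adj.
have : 0 <= Re (conjc x * x) by case: (x) => u v /=; rewrite mulNr opprK addr_ge0 // -expr2 sqr_ge0.
have := hsip_ge0 a; have := hsip_ge0 b.
set u := hsip a a; set v := hsip b b; set w := Re _ => v0 u0 w0.
have [->|w1] := eqVneq w 0; first by rewrite mulr_ge0.
have wp : 0 < w by rewrite lt_def w1.
by rewrite expr2 mulrCA ler_pM2l.
Qed.
End HilbertSchmidt.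

(** * Operator bounds and the normalised Frobenius norm *)

Section Bounds.
Context {R : realType}.
Local Notation C := (R[i]).
Local Notation Re := (@complex.Re R).

(** Operator bounds are kept as multiplier bounds on the Hilbert-Schmidt norm, from both sides: the
    form in which every later estimate uses them. *)
Definition op_le {d} (K : R) (A : 'M[C]_d) : Prop :=
  0 <= K /\ forall B : 'M[C]_d,
    hsnorm (A *m B) <= K * hsnorm B /\ hsnorm (B *m A) <= K * hsnorm B.

(** With [X] the adjoint of [B], [|A^* X|^2 = <X, A A^* X> <= K |X| |A^* X|]; one factor [|A^* X|]
    cancels. *)
Lemma op_le_left d K (A : 'M[C]_d) : 0 <= K ->
  (forall B : 'M[C]_d, hsnorm (A *m B) <= K * hsnorm B) -> op_le K A.
Proof.
move=> K0 h; split=> // B; split; first exact: h.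
rewrite -hsnorm_adj adjmxM; set X := adjmx B.
have [->|n0] := eqVneq (hsnorm (adjmx A *m X)) 0.
  by rewrite mulr_ge0 // hsnorm_ge0.
have np : 0 < hsnorm (adjmx A *m X) by rewrite lt_def n0 hsnorm_ge0.
rewrite -(ler_pM2r np) -expr2 hsnorm_sqr hsip_mull adjmxK.
apply: (le_trans (hsip_cs _ _)); rewrite -[hsnorm B]hsnorm_adj mulrAC mulrC.
by rewrite ler_wpM2r ?hsnorm_ge0.
Qed.

(** The supremum is over a non-empty bounded set: [0 < d] supplies a unit vector, the Frobenius norm
    an upper bound. Homogeneity extends the bound to all vectors, and summing over columns to
    matrices. *)
Lemma opnorm_op_le d K (A : 'M[C]_d) : (0 < d)%N -> opnorm A <= K -> op_le K A.
Proof.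
move=> d0 AK.
move: AK; rewrite /opnorm; set S := (X in sup X) => AK.
have Sub : has_sup S.
  split.
    exists (vnorm (A *m delta_mx (Ordinal d0) 0 : 'cV[C]_d)).
    exists (delta_mx (Ordinal d0) 0); split=> //.
    by rewrite /vnorm /adjmx /entconjmx map_delta_mx trmx_delta mul_delta_mx mxE !eqxx /= sqrtr1.
  exists (hsnorm A) => _ [v [v1 ->]].
  by rewrite vnormE; apply: (le_trans (hsnormM _ _)); rewrite -[hsnorm v]vnormE v1 mulr1.
have Av (v : 'cV[C]_d) : vnorm v = 1 -> vnorm (A *m v) <= K.
  by move=> v1; apply: le_trans AK; apply: ub_le_sup => //; [exact: Sub.2 | exists v].
have K0 : 0 <= K.
  case: Sub.1 => _ [v [v1 _]]; apply: le_trans (Av v v1).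
  by rewrite vnormE hsnorm_ge0.
have Avv (v : 'cV[C]_d) : hsnorm (A *m v) <= K * hsnorm v.
  have [v0|v0] := eqVneq (hsnorm v) 0.
    by apply: (le_trans (hsnormM _ _)); rewrite v0 !mulr0.
  have vp : 0 < hsnorm v by rewrite lt_def v0 hsnorm_ge0.
  have := Av ((hsnorm v)^-1%:C *: v).
  rewrite !vnormE -scalemxAr !hsnormZ gtr0_norm ?invr_gt0 // mulVf //.
  by move/(_ erefl); rewrite ler_pdivrMl // mulrC.
apply: op_le_left => // B; apply: hsnorm_le_sqr => //.
rewrite hsip_col (hsip_col B) mulr_sumr; apply: ler_sum => j _.
have -> : col j (A *m B) = A *m col j B.
  by apply/matrixP => k l; rewrite !mxE; apply: eq_bigr => i _; rewrite !mxE.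
by rewrite -!hsnorm_sqr -exprMn ler_pXn2r ?nnegrE ?mulr_ge0 ?hsnorm_ge0 // mulrC.
Qed.

Lemma op_le1 d : op_le 1 (1%:M : 'M[C]_d).
Proof. by split=> // B; rewrite mul1mx mulmx1 mul1r. Qed.

Lemma op_leM d K L (A B : 'M[C]_d) : op_le K A -> op_le L B -> op_le (K * L) (A *m B).
Proof.
move=> [K0 hA] [L0 hB]; split=> [|X]; first exact: mulr_ge0.
split.
  rewrite -mulmxA -mulrA; apply: (le_trans (hA _).1).
  by rewrite ler_wpM2l // (hB _).1.
rewrite mulmxA [K * L]mulrC -mulrA; apply: (le_trans (hB _).2).
by rewrite ler_wpM2l // (hA _).2.
Qed.

Lemma op_leD d K L (A B : 'M[C]_d) : op_le K A -> op_le L B -> op_le (K + L) (A + B).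
Proof.
move=> [K0 hA] [L0 hB]; split=> [|X]; first exact: addr_ge0.
rewrite mulmxDl mulmxDr mulrDl; split; apply: (le_trans (hsnormD _ _)); apply: lerD.
- exact: (hA _).1.
- exact: (hB _).1.
- exact: (hA _).2.
- exact: (hB _).2.
Qed.

Lemma op_leZ d K k (A : 'M[C]_d) : op_le K A -> op_le (`|k| * K) (k%:C *: A).
Proof.
move=> [K0 hA]; split=> [|X]; first by rewrite mulr_ge0.
have [hl hr] := hA X.
rewrite -scalemxAl -scalemxAr 2!hsnormZ -mulrA.
by split; apply: ler_wpM2l; rewrite ?normr_ge0 ?hl ?hr.
Qed.

Lemma op_le_adj d K (A : 'M[C]_d) : op_le K A -> op_le K (adjmx A).
Proof.
case=> K0 hA; split=> [//|X]; have [hl hr] := hA (adjmx X).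
by split; rewrite -hsnorm_adj -[hsnorm X]hsnorm_adj adjmxM adjmxK.
Qed.

Lemma op_le_proj d (P : 'M[C]_d) : is_proj P -> op_le 1 P.
Proof.
move=> [PP Pa]; apply: op_le_left => // B; rewrite mul1r.
have [->|n0] := eqVneq (hsnorm (P *m B)) 0; first exact: hsnorm_ge0.
have np : 0 < hsnorm (P *m B) by rewrite lt_def n0 hsnorm_ge0.
rewrite -(ler_pM2r np) -expr2 hsnorm_sqr hsip_mull Pa mulmxA PP.
exact: hsip_cs.
Qed.

Lemma op_le_sa_unitary d (X : 'M[C]_d) : is_sa_unitary X -> op_le 1 X.
Proof.
move=> [Xa [XX _]]; apply: op_le_left => // B; apply: hsnorm_le_sqr => //.
by rewrite hsip_mull mulmxA XX mul1mx expr1n mul1r.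
Qed.

Lemma fnormE d (A : 'M[C]_d) : fnorm A = hsnorm A / Num.sqrt d%:R.
Proof. by []. Qed.

Lemma fnorm_ge0 d (A : 'M[C]_d) : 0 <= fnorm A.
Proof. by rewrite fnormE divr_ge0 ?hsnorm_ge0 ?sqrtr_ge0. Qed.

Lemma ler_fnorm d d' p q (A : 'M[C]_d) (B : 'M[C]_(p, q)) K : d = d' ->
  hsnorm A <= K * hsnorm B -> fnorm A <= K * (hsnorm B / Num.sqrt d'%:R).
Proof. by move=> <- h; rewrite fnormE mulrA ler_wpM2r // invr_ge0 sqrtr_ge0. Qed.

Lemma fnormD d (A B : 'M[C]_d) : fnorm (A + B) <= fnorm A + fnorm B.
Proof. by rewrite !fnormE -mulrDl ler_wpM2r ?hsnormD // invr_ge0 sqrtr_ge0. Qed.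

Lemma fnormN d (A : 'M[C]_d) : fnorm (- A) = fnorm A.
Proof. by rewrite !fnormE hsnormN. Qed.

Lemma fnormZ d k (A : 'M[C]_d) : fnorm (k%:C *: A) = `|k| * fnorm A.
Proof. by rewrite !fnormE hsnormZ mulrA. Qed.

Lemma fnorm_adj d (A : 'M[C]_d) : fnorm (adjmx A) = fnorm A.
Proof. by rewrite !fnormE hsnorm_adj. Qed.

Lemma fnorm0 d : fnorm (0 : 'M[C]_d) = 0.
Proof. by rewrite fnormE /hsnorm /hsip mulmx0 linear0 sqrtr0 mul0r. Qed.

Lemma fnorm1 d : (0 < d)%N -> fnorm (1%:M : 'M[C]_d) = 1.
Proof.
move=> d0; rewrite fnormE /hsnorm /hsip adjmx1 mulmx1 mxtrace1.
have -> : Re (d%:R : C) = d%:R.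
  by elim: d {d0} => //= d IH; rewrite !mulrS ReD IH.
by rewrite divff // sqrtr_eq0 -ltNge ltr0n.
Qed.

Lemma fnormMl d K (A B : 'M[C]_d) : op_le K A -> fnorm (A *m B) <= K * fnorm B.
Proof. by case=> _ h; apply: ler_fnorm => //; exact: (h B).1. Qed.

Lemma fnormMr d K (A B : 'M[C]_d) : op_le K A -> fnorm (B *m A) <= K * fnorm B.
Proof. by case=> _ h; apply: ler_fnorm => //; exact: (h B).2. Qed.

End Bounds.

(* Keeps unification from unfolding the norms down to matrix entries. *)
Global Opaque hsip hsnorm fnorm.

(** * Functional calculus and rounding *)

Section FunctionalCalculus.
Context {R : realType}.
Local Notation C := (R[i]).
Local Notation Re := (@complex.Re R).

Definition hermitian_part {d} (A : 'M[C]_d) : 'M[C]_d := (2^-1)%:C *: (A + adjmx A).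

Lemma adjmx_hermitian_part d (A : 'M[C]_d) : adjmx (hermitian_part A) = hermitian_part A.
Proof. by rewrite adjmxZ adjmxD adjmxK addrC. Qed.

Definition eigval {d} (H : 'M[C]_d) (i : 'I_d) : R := Re (spectral_diag H 0 i).

Definition rdiag {d} (l : 'I_d -> R) : 'M[C]_d := diag_mx (\row_i (l i)%:C).

(** Defined for every [H], since [spectralmx H] is always unitary; it is the functional calculus
    f(H) when [H] is self-adjoint, which enters through [fcalc_id]. *)
Definition fcalc {d} (f : R -> R) (H : 'M[C]_d) : 'M[C]_d :=
  adjmx (spectralmx H) *m rdiag (fun i => f (eigval H i)) *m spectralmx H.

Lemma adjmxCE m n (A : 'M[C]_(m, n)) : map_mx Num.conj (A^T) = adjmx A.
Proof. by apply/matrixP => i j; rewrite !mxE. Qed.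

Lemma spectralmx_mulr d (H : 'M[C]_d) : spectralmx H *m adjmx (spectralmx H) = 1%:M.
Proof. by have /unitarymxP := spectral_unitarymx H; rewrite adjmxCE. Qed.

Lemma spectralmx_mull d (H : 'M[C]_d) : adjmx (spectralmx H) *m spectralmx H = 1%:M.
Proof. exact/mulmx1C/spectralmx_mulr. Qed.

Lemma fcalc_id d (H : 'M[C]_d) : adjmx H = H -> fcalc id H = H.
Proof.
move=> Ha.
have Hh : H \is hermsymmx.
  by apply/is_hermitianmxP; rewrite expr0 scale1r adjmxCE Ha.
have /orthomx_spectralP E := hermitian_normalmx Hh.
have /mxOverP sr := hermitian_spectral_diag_real Hh.
have {}E : H = adjmx (spectralmx H) *m diag_mx (spectral_diag H) *m spectralmx H.
  by rewrite -adjmxCE -(invmx_unitary (spectral_unitarymx H)).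
apply: etrans (esym E); rewrite /fcalc /rdiag.
have -> // : \row_i (eigval H i)%:C = spectral_diag H.
by apply/rowP => i; rewrite mxE /eigval RRe_real.
Qed.

Lemma eq_fcalc d (H : 'M[C]_d) f g : f =1 g -> fcalc f H = fcalc g H.
Proof.
by move=> fg; congr (_ *m diag_mx _ *m _); apply/matrixP => i j; rewrite !mxE fg.
Qed.

Lemma fcalcM d (H : 'M[C]_d) f g :
  fcalc f H *m fcalc g H = fcalc (fun x => f x * g x) H.
Proof.
rewrite /fcalc -!mulmxA (mulmxA (spectralmx H)) spectralmx_mulr mul1mx.
rewrite (mulmxA (rdiag _)) mulmx_diag; congr (_ *m (diag_mx _ *m _)).
by apply/matrixP => i j; rewrite !mxE rmorphM.
Qed.

Lemma fcalcD d (H : 'M[C]_d) f g :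
  fcalc f H + fcalc g H = fcalc (fun x => f x + g x) H.
Proof.
rewrite /fcalc -mulmxDl -mulmxDr -raddfD /=; congr (_ *m diag_mx _ *m _).
by apply/matrixP => i j; rewrite !mxE rmorphD.
Qed.

Lemma fcalcZ d (H : 'M[C]_d) k f :
  k%:C *: fcalc f H = fcalc (fun x => k * f x) H.
Proof.
rewrite /fcalc scalemxAl scalemxAr -linearZ /=; congr (_ *m diag_mx _ *m _).
by apply/matrixP => i j; rewrite !mxE rmorphM.
Qed.

Lemma fcalc1 d (H : 'M[C]_d) : fcalc (fun=> 1) H = 1%:M.
Proof.
have -> : fcalc (fun=> 1) H = adjmx (spectralmx H) *m 1%:M *m spectralmx H.
  by rewrite -diag_const_mx; congr (_ *m diag_mx _ *m _); apply/matrixP=> i j; rewrite !mxE.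
by rewrite mulmx1 spectralmx_mull.
Qed.

Lemma fcalc0 d (H : 'M[C]_d) : fcalc (fun=> 0) H = 0.
Proof. by have := fcalcZ H 0 (fun=> 0); rewrite scale0r mul0r => <-. Qed.

Lemma fcalc_sum d (H : 'M[C]_d) (I : Type) (s : seq I) (F : I -> R -> R) :
  \sum_(i <- s) fcalc (F i) H = fcalc (fun x => \sum_(i <- s) F i x) H.
Proof.
elim: s => [|i s IH].
  by rewrite big_nil -(fcalc0 H); apply: eq_fcalc => x; rewrite big_nil.
by rewrite big_cons IH fcalcD; apply: eq_fcalc => x; rewrite big_cons.
Qed.

Lemma adjmx_fcalc d (H : 'M[C]_d) f : adjmx (fcalc f H) = fcalc f H.
Proof.
rewrite /fcalc !adjmxM adjmxK mulmxA; congr (_ *m _ *m _).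
apply/matrixP => i j; rewrite !mxE eq_sym; case: eqP => [->|_].
  by rewrite !mulr1n conjc_real.
by rewrite !mulr0n conjc0.
Qed.

(** In the eigenbasis, f(H) multiplies the rows of [B] by the values of [f], so the squared norm is
    a weighted sum of squares and a scalar inequality transfers term by term. *)
Lemma fcalc_hsnorm_le d p (H : 'M[C]_d) f g K (B : 'M[C]_(d, p)) : 0 <= K ->
  (forall x, `|f x| <= K * `|g x|) ->
  hsnorm (fcalc f H *m B) <= K * hsnorm (fcalc g H *m B).
Proof.
move=> K0 fg; apply: hsnorm_le_sqr => //.
have red h : hsip (fcalc h H *m B) (fcalc h H *m B) =
    \sum_i \sum_j h (eigval H i) ^+ 2 *
      Re (conjc ((spectralmx H *m B) i j) * (spectralmx H *m B) i j).
  rewrite /fcalc -!mulmxA hsip_mull adjmxK (mulmxA (spectralmx H) (adjmx _)).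
  rewrite spectralmx_mulr mul1mx hsipE.
  apply: eq_bigr => i _; apply: eq_bigr => j _.
  rewrite mul_diag_mx mxE mxE; case: ((spectralmx H *m B) i j) => a b /=; ring.
rewrite !red mulr_sumr; apply: ler_sum => i _; rewrite mulr_sumr; apply: ler_sum => j _.
rewrite mulrA ler_wpM2r //.
  by case: (_ i j) => a b /=; rewrite mulNr opprK addr_ge0 // -expr2 sqr_ge0.
rewrite -[leLHS]real_normK ?num_real // -[X in _ * X]real_normK ?num_real //.
by rewrite -exprMn ler_pXn2r ?nnegrE ?mulr_ge0.
Qed.

(** The value at 0 is 1, so that the square is 1 everywhere and [sign_mx] is exactly unitary. *)
Definition sign_val (x : R) : R := if 0 <= x then 1 else -1.
Definition sign_mx {d} (A : 'M[C]_d) : 'M[C]_d := fcalc sign_val (hermitian_part A).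

Lemma sign_mx_sa_unitary d (A : 'M[C]_d) : is_sa_unitary (sign_mx A).
Proof.
have E : sign_mx A *m sign_mx A = 1%:M.
  rewrite /sign_mx fcalcM -(fcalc1 (hermitian_part A)); apply: eq_fcalc => x.
  by rewrite /sign_val; case: ifP => _; rewrite ?mulr1 // mulrNN mulr1.
by rewrite /is_sa_unitary {1 2 3}/sign_mx !adjmx_fcalc.
Qed.

(** The scalar [x * x - 1] is the product of [sign_val x - x] and a factor of modulus
    [1 + |x| >= 1]. *)
Lemma sign_mx_dist d (A : 'M[C]_d) (H := hermitian_part A) :
  fnorm (sign_mx A - H) <= fnorm (H *m H - 1%:M).
Proof.
have Ha : adjmx H = H by exact: adjmx_hermitian_part.
have -> : sign_mx A - H = fcalc (fun x => sign_val x - x) H *m 1%:M.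
  rewrite mulmx1 -[in LHS](fcalc_id Ha) /sign_mx -/H (fcalc_id Ha).
  rewrite -[X in _ - X](fcalc_id Ha) -scaleN1r.
  have -> : (-1 : C) = (-1)%:C by rewrite rmorphN1.
  by rewrite fcalcZ fcalcD; apply: eq_fcalc => x; rewrite mulN1r.
have -> : H *m H - 1%:M = fcalc (fun x => x * x - 1) H *m 1%:M.
  rewrite mulmx1 -[X in X *m X](fcalc_id Ha) fcalcM -(fcalc1 H) -scaleN1r.
  have -> : (-1 : C) = (-1)%:C by rewrite rmorphN1.
  by rewrite fcalcZ fcalcD; apply: eq_fcalc => x; rewrite mulN1r.
rewrite -[leRHS]mul1r; apply: ler_fnorm => //; apply: fcalc_hsnorm_le => // x.
rewrite mul1r /sign_val; case: ifP => [x0|/negbT]; last rewrite -ltNge => x0.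
  rewrite (_ : x * x - 1 = (1 - x) * (- 1 - x)); last by ring.
  by rewrite normrM ler_peMr // ler0_norm; lra.
rewrite (_ : x * x - 1 = (-1 - x) * (1 - x)); last by ring.
by rewrite normrM ler_peMr // ger0_norm; lra.
Qed.

End FunctionalCalculus.

(** * Spectral projections of a Hermitian matrix *)

Section Spectral.
Context {R : realType}.
Local Notation C := (R[i]).

(** [near] cuts the real line into cells indexed by outcomes; the projection belongs to the cell of
    [a]. Orthogonality and completeness are then exact. *)
Definition spectral_proj {A : eqType} {d} (near : R -> A) (H : 'M[C]_d) (a : A) : 'M[C]_d :=
  fcalc (fun x => (near x == a)%:R) H.

Lemma spectral_projM (A : eqType) d (near : R -> A) (H : 'M[C]_d) a b :
  spectral_proj near H a *m spectral_proj near H b =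
  if a == b then spectral_proj near H a else 0.
Proof.
rewrite /spectral_proj fcalcM; case: ifP => ab.
  by rewrite -(eqP ab); apply: eq_fcalc => x; case: eqP; rewrite ?mulr1 ?mulr0.
rewrite -(fcalc0 H); apply: eq_fcalc => x.
by case: eqP => [->|_]; rewrite ?ab ?mulr0 ?mul0r.
Qed.

Lemma spectral_proj_is_proj (A : eqType) d (near : R -> A) (H : 'M[C]_d) a :
  is_proj (spectral_proj near H a).
Proof. by split; [rewrite spectral_projM eqxx | exact: adjmx_fcalc]. Qed.

Lemma spectral_proj_pvm (A : finType) d (near : R -> A) (H : 'M[C]_d) :
  is_pvm (spectral_proj near H).
Proof.
split=> [a|]; first exact: spectral_proj_is_proj.
rewrite fcalc_sum -(fcalc1 H); apply: eq_fcalc => x.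
rewrite (bigD1 (near x)) //= eqxx big1 ?addr0 // => b.
by rewrite eq_sym => /negbTE ->.
Qed.

Lemma spectral_proj_eq0 (A : eqType) d (near : R -> A) (H : 'M[C]_d) a :
  (forall x, near x != a) -> spectral_proj near H a = 0.
Proof. by move=> n; rewrite -(fcalc0 H); apply: eq_fcalc => x; rewrite (negbTE (n x)). Qed.

Lemma fcalc_id_subr d (H : 'M[C]_d) k : adjmx H = H ->
  fcalc (fun x => x - k) H = H - k%:C *: 1%:M.
Proof.
move=> Ha; rewrite -[X in X - _](fcalc_id Ha) -(fcalc1 H) -scaleNr -rmorphN fcalcZ fcalcD.
by apply: eq_fcalc => x; rewrite mulr1.
Qed.
End Spectral.

(** * Families of matrices up to errors linear in [eps] *)

Section Families.
Context {R : realType} {T : Type} (eps : T -> R) (d : T -> nat).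
Hypothesis eps_ge0 : forall t, 0 <= eps t.
Local Notation C := (R[i]).
Local Notation family := (forall t, 'M[C]_(d t)).

Definition ubounded (M : family) : Prop := exists K, forall t, op_le K (M t).

(** The constant is chosen before the index [t], so it is uniform over all dimensions occurring in
    the family. *)
Definition approx (M N : family) : Prop :=
  exists2 c, 0 <= c & forall t, fnorm (M t - N t) <= c * eps t.

Lemma ubounded1 : ubounded (fun t => 1%:M).
Proof. by exists 1 => t; exact: op_le1. Qed.

Lemma ubounded_proj M : (forall t, is_proj (M t)) -> ubounded M.
Proof. by move=> h; exists 1 => t; exact: op_le_proj. Qed.

Lemma ubounded_sa_unitary M : (forall t, is_sa_unitary (M t)) -> ubounded M.
Proof. by move=> h; exists 1 => t; exact: op_le_sa_unitary. Qed.

Lemma uboundedM M N : ubounded M -> ubounded N -> ubounded (fun t => M t *m N t).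
Proof. by move=> [K hK] [L hL]; exists (K * L) => t; exact: op_leM. Qed.

Lemma uboundedD M N : ubounded M -> ubounded N -> ubounded (fun t => M t + N t).
Proof. by move=> [K hK] [L hL]; exists (K + L) => t; exact: op_leD. Qed.

Lemma uboundedZ k M : ubounded M -> ubounded (fun t => k%:C *: M t).
Proof. by move=> [K hK]; exists (`|k| * K) => t; exact: op_leZ. Qed.

Lemma ubounded_adj M : ubounded M -> ubounded (fun t => adjmx (M t)).
Proof. by move=> [K hK]; exists K => t; exact: op_le_adj. Qed.

Lemma ubounded0 : ubounded (fun t => 0).
Proof.
have [K h] := uboundedZ 0 ubounded1; exists K => t.
by have := h t; rewrite scale0r.
Qed.

Lemma ubounded_sum (I : Type) (s : seq I) (F : I -> family) :
  (forall i, ubounded (F i)) -> ubounded (fun t => \sum_(i <- s) F i t).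
Proof.
move=> h; elim: s => [|i s [K hK]].
  by have [K hK] := ubounded0; exists K => t; rewrite big_nil.
have [L hL] := uboundedD (h i) (ex_intro _ K hK).
by exists L => t; rewrite big_cons.
Qed.

Lemma approx_eq M N : (forall t, M t = N t) -> approx M N.
Proof. by move=> e; exists 0 => [//|t]; rewrite e subrr fnorm0 mul0r. Qed.

Lemma approx_refl M : approx M M.
Proof. exact: approx_eq. Qed.

Lemma approx_sym M N : approx M N -> approx N M.
Proof. by move=> [c c0 h]; exists c => [//|t]; rewrite -fnormN opprB. Qed.

Lemma approx_trans N M P : approx M N -> approx N P -> approx M P.
Proof.
move=> [c c0 h] [e e0 k]; exists (c + e) => [|t]; first exact: addr_ge0.
have -> : M t - P t = (M t - N t) + (N t - P t) by rewrite addrA subrK.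
by rewrite mulrDl; apply: (le_trans (fnormD _ _)); apply: lerD.
Qed.

Lemma approxD M M' N N' : approx M M' -> approx N N' ->
  approx (fun t => M t + N t) (fun t => M' t + N' t).
Proof.
move=> [c c0 h] [e e0 k]; exists (c + e) => [|t]; first exact: addr_ge0.
rewrite opprD addrACA mulrDl; apply: (le_trans (fnormD _ _)); exact: lerD.
Qed.

Lemma approxZ k M M' : approx M M' ->
  approx (fun t => k%:C *: M t) (fun t => k%:C *: M' t).
Proof.
move=> [c c0 h]; exists (`|k| * c) => [|t]; first by rewrite mulr_ge0.
by rewrite -scalerBr fnormZ -mulrA ler_wpM2l.
Qed.

Lemma approx_adj M M' : approx M M' ->
  approx (fun t => adjmx (M t)) (fun t => adjmx (M' t)).
Proof. by move=> [c c0 h]; exists c => [//|t]; rewrite -adjmxB fnorm_adj. Qed.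

Lemma approxMl M N N' : ubounded M -> approx N N' ->
  approx (fun t => M t *m N t) (fun t => M t *m N' t).
Proof.
(* The absolute value makes the constant non-negative even if [T] is empty: [hK] yields [0 <= K]
   only at some index. *)
move=> [K hK] [c c0 h]; exists (`|K| * c) => [|t]; first by rewrite mulr_ge0.
rewrite -mulmxBr -mulrA; apply: (le_trans (fnormMl _ (hK t))).
apply: (le_trans (ler_wpM2l _ (h t))); first by case: (hK t).
by rewrite ler_wpM2r ?ler_norm // mulr_ge0.
Qed.

Lemma approxMr M N N' : ubounded M -> approx N N' ->
  approx (fun t => N t *m M t) (fun t => N' t *m M t).
Proof.
move=> [K hK] [c c0 h]; exists (`|K| * c) => [|t]; first by rewrite mulr_ge0.
rewrite -mulmxBl -mulrA; apply: (le_trans (fnormMr _ (hK t))).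
apply: (le_trans (ler_wpM2l _ (h t))); first by case: (hK t).
by rewrite ler_wpM2r ?ler_norm // mulr_ge0.
Qed.

Lemma approx_sum (I : Type) (s : seq I) (P : pred I) (F G : I -> family) :
  (forall i, P i -> approx (F i) (G i)) ->
  approx (fun t => \sum_(i <- s | P i) F i t) (fun t => \sum_(i <- s | P i) G i t).
Proof.
move=> h; elim: s => [|i s IH]; first by apply: approx_eq => t; rewrite !big_nil.
have [Pi|nPi] := boolP (P i); last first.
  by have [c c0 k] := IH; exists c => [//|t]; rewrite !big_cons (negbTE nPi).
have [c c0 k] := approxD (h i Pi) IH.
by exists c => [//|t]; rewrite !big_cons Pi.
Qed.

Lemma approx_sum0 (I : Type) (s : seq I) (P : pred I) (F : I -> family) :
  (forall i, P i -> approx (F i) (fun t => 0)) ->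
  approx (fun t => \sum_(i <- s | P i) F i t) (fun t => 0).
Proof.
move=> /(approx_sum s) h; apply: (approx_trans h).
by apply: approx_eq => t; rewrite big1.
Qed.

Lemma approx_hermitian_part M : approx M (fun t => adjmx (M t)) ->
  approx (fun t => hermitian_part (M t)) M.
Proof.
move=> h; apply: approx_trans (approxZ 2^-1 (approxD (approx_refl M) (approx_sym h))) _.
apply: approx_eq => t; rewrite -mulr2n -scaler_nat scalerA.
have -> : (2^-1)%:C * 2%:R = 1 :> C.
  by rewrite -(rmorph_nat (real_complex R)) -rmorphM mulVf // pnatr_eq0.
by rewrite scale1r.
Qed.

(** The Hermitian part is close to [M], and both are bounded, so its square is close to [M] squared
    and hence to the identity; then [sign_mx_dist] applies. *)
Lemma sign_mx_approx M : ubounded M -> approx M (fun t => adjmx (M t)) ->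
  approx (fun t => M t *m M t) (fun t => 1%:M) ->
  approx (fun t => sign_mx (M t)) M.
Proof.
move=> Mb Ma M2; have Hh := approx_hermitian_part Ma.
apply: approx_trans (Hh).
have Hb : ubounded (fun t => hermitian_part (M t)).
  exact/uboundedZ/uboundedD/ubounded_adj.
have [c c0 h] : approx (fun t => hermitian_part (M t) *m hermitian_part (M t)) (fun t => 1%:M).
  exact: approx_trans (approxMl Hb Hh) (approx_trans (approxMr Mb Hh) M2).
by exists c => [//|t]; apply: (le_trans (sign_mx_dist _)).
Qed.

(** * Rounding an approximate projection-valued measure *)

Section PvmRounding.
Variables (A : finType) (p : pred A) (a0 : A) (P : A -> family).
Hypotheses (pa0 : p a0) (Pb : forall a, ubounded (P a)).
Hypothesis Psa : forall a, approx (P a) (fun t => adjmx (P a t)).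
Hypothesis Porth : forall a b,
  approx (fun t => P a t *m P b t) (fun t => if a == b then P a t else 0).
Hypothesis Psum : approx (fun t => \sum_a P a t) (fun t => 1%:M).
Hypothesis Pout : forall a, ~~ p a -> approx (P a) (fun t => 0).

Definition label (a : A) : R := (enum_rank a)%:R.

(* The approximate projections are encoded in one Hermitian matrix having
   approximate eigenvalue [label a] on the range of [P a]; the exact projections
   are the spectral projections onto the eigenvalues closest to each label. *)
Definition label_mx t : 'M[C]_(d t) :=
  \sum_a (label a)%:C *: hermitian_part (P a t).

(** Only outcomes satisfying [p] compete, so all others receive exactly the zero projection; [a0]
    shows that the minimum is over a non-empty set. *)
Definition nearest (x : R) : A := [arg min_(a < a0 | p a) `|x - label a|]%O.

Definition round_pvm (a : A) t : 'M[C]_(d t) := spectral_proj nearest (label_mx t) a.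

Lemma label_dist a b : a != b -> 1 <= `|label a - label b|.
Proof.
move=> ab; rewrite /label distrC; have : enum_rank a != enum_rank b :> nat.
  by apply: contra ab => /eqP /val_inj /enum_rank_inj ->.
rewrite neq_ltn => /orP[] lt; last rewrite distrC.
  by rewrite -natrB 1?ltnW // normr_nat ler1n subn_gt0.
by rewrite -natrB 1?ltnW // normr_nat ler1n subn_gt0.
Qed.

Lemma nearest_in x : p (nearest x).
Proof. by rewrite /nearest; case: arg_minP. Qed.

(** Labels are at least 1 apart, so by the triangle inequality a point assigned to another label is
    at least 1/2 away from this one. *)
Lemma nearest_dist x a : p a -> nearest x != a -> 1 <= 2 * `|x - label a|.
Proof.
move=> pa na; apply: (le_trans (label_dist na)).
have : `|x - label (nearest x)| <= `|x - label a|.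
  by rewrite /nearest; case: arg_minP => //= b _; exact.
have : `|label (nearest x) - label a| <= `|x - label (nearest x)| + `|x - label a|.
  by rewrite [X in _ <= X + _]distrC; exact: ler_distD.
move: (`|_|) (`|_|) (`|_|) => x1 x2 x3; lra.
Qed.

Lemma label_mx_sa t : adjmx (label_mx t) = label_mx t.
Proof.
by rewrite /label_mx adjmx_sum; apply: eq_bigr => a _; rewrite adjmxZ adjmx_hermitian_part.
Qed.

Lemma label_mx_eigen a :
  approx (fun t => label_mx t *m P a t) (fun t => (label a)%:C *: P a t).
Proof.
have h : approx label_mx (fun t => \sum_b (label b)%:C *: P b t).
  by apply: approx_sum => b _; apply: approxZ; apply: approx_hermitian_part; exact: Psa.
apply: approx_trans (approxMr (Pb a) h) _.
have k : approx (fun t => \sum_b (label b)%:C *: (P b t *m P a t))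
    (fun t => \sum_b (label b)%:C *: (if b == a then P b t else 0)).
  by apply: approx_sum => b _; apply: approxZ; exact: Porth.
apply: approx_trans (approx_trans k _); apply: approx_eq => t.
  by rewrite mulmx_suml; apply: eq_bigr => b _; rewrite scalemxAl.
by rewrite (bigD1 a) //= eqxx big1 ?addr0 // => b /negbTE ->; rewrite scaler0.
Qed.

Lemma ubounded_round_pvm a : ubounded (round_pvm a).
Proof. by apply: ubounded_proj => t; exact: spectral_proj_is_proj. Qed.

Lemma round_pvm_out a t : ~~ p a -> round_pvm a t = 0.
Proof.
by move=> npa; apply: spectral_proj_eq0 => x; apply: contra npa => /eqP <-; exact: nearest_in.
Qed.

(** For [a] in [p], the indicator of the cell of [b] is at most [2 * |x - label a|], so the
    approximate eigenvalue equation for [P a] bounds the product. For [a] outside [p], [P a] itself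
    is small. *)
Lemma round_pvm_orth a b : b != a ->
  approx (fun t => round_pvm b t *m P a t) (fun t => 0).
Proof.
move=> ba; have [pa|npa] := boolP (p a); last first.
  apply: approx_trans (approxMl (ubounded_round_pvm b) (Pout npa)) _.
  by apply: approx_eq => t; rewrite mulmx0.
have [c c0 h] := label_mx_eigen a.
exists (2 * c) => [|t]; first by rewrite mulr_ge0.
rewrite subr0 -mulrA; apply: le_trans (ler_wpM2l _ (h t)) => //.
have -> : label_mx t *m P a t - (label a)%:C *: P a t =
    fcalc (fun x => x - label a) (label_mx t) *m P a t.
  by rewrite fcalc_id_subr ?label_mx_sa // mulmxBl -scalemxAl mul1mx.
apply: ler_fnorm => //; apply: fcalc_hsnorm_le => // x.
case: eqP => [nb|_]; last by rewrite normr0 mulr_ge0.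
by rewrite normr1; apply: nearest_dist; rewrite // nb.
Qed.

(** Both sides are close to [round_pvm a t *m P a t]: multiply the approximate resolution of the
    identity by [round_pvm a] on the left, and the exact one by [P a] on the right. *)
Lemma round_pvm_approx a : approx (round_pvm a) (P a).
Proof.
apply: (approx_trans (N := fun t => round_pvm a t *m P a t)).
  apply: (approx_trans (N := fun t => round_pvm a t *m \sum_b P b t)).
    apply: approx_trans (approx_sym (approxMl (ubounded_round_pvm a) Psum)).
    by apply: approx_eq => t; rewrite mulmx1.
  apply: (approx_trans (N := fun t => round_pvm a t *m P a t +
      \sum_(b | b != a) round_pvm a t *m P b t)).
    by apply: approx_eq => t; rewrite mulmx_sumr (bigD1 a).
  apply: (approx_trans (N := fun t => round_pvm a t *m P a t + 0)).
    apply: approxD (approx_refl _) _; apply: approx_sum0 => b ba.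
    by apply: round_pvm_orth; rewrite eq_sym.
  by apply: approx_eq => t; rewrite addr0.
apply: approx_sym; apply: (approx_trans (N := fun t => round_pvm a t *m P a t +
    \sum_(b | b != a) round_pvm b t *m P a t)).
  apply: approx_eq => t; rewrite -[LHS]mul1mx.
  by rewrite -(spectral_proj_pvm nearest (label_mx t)).2 mulmx_suml (bigD1 a).
apply: (approx_trans (N := fun t => round_pvm a t *m P a t + 0)).
  by apply: approxD (approx_refl _) _; apply: approx_sum0 => b ba; exact: round_pvm_orth.
by apply: approx_eq => t; rewrite addr0.
Qed.

End PvmRounding.
End Families.

(** * The maximally entangled state *)

Section MaxEnt.
Context {R : realType}.
Local Notation C := (R[i]).
Local Notation Re := (@complex.Re R).

Definition nip {d} (A B : 'M[C]_d) : R := hsip A B / d%:R.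

Lemma nipE d (A B : 'M[C]_d) : nip A B = hsip A B / d%:R.
Proof. by []. Qed.

Lemma fnorm_sqr d (A : 'M[C]_d) : fnorm A ^+ 2 = nip A A.
Proof. by rewrite fnormE exprMn hsnorm_sqr exprVn sqr_sqrtr. Qed.

Lemma nipD d (A B B' : 'M[C]_d) : nip A (B + B') = nip A B + nip A B'.
Proof. by rewrite !nipE hsipDr mulrDl. Qed.

Lemma nip_sym d (A B : 'M[C]_d) : nip A B = nip B A.
Proof. by rewrite !nipE hsip_sym. Qed.

Lemma nip_suml d (I : Type) (s : seq I) (P : pred I) (F : I -> 'M[C]_d) B :
  nip (\sum_(i <- s | P i) F i) B = \sum_(i <- s | P i) nip (F i) B.
Proof. by rewrite nipE hsip_suml mulr_suml. Qed.

Lemma nip_sumr d (I : Type) (s : seq I) (P : pred I) (F : I -> 'M[C]_d) B :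
  nip B (\sum_(i <- s | P i) F i) = \sum_(i <- s | P i) nip B (F i).
Proof. by rewrite nipE hsip_sumr mulr_suml. Qed.

Lemma nipZr d k (A B : 'M[C]_d) : nip A (k%:C *: B) = k * nip A B.
Proof. by rewrite !nipE hsipZr mulrA. Qed.

Lemma nip_cs d (A B : 'M[C]_d) : nip A B <= fnorm A * fnorm B.
Proof.
rewrite nipE !fnormE mulrACA -invfM -expr2 sqr_sqrtr // ler_wpM2r ?hsip_cs //.
by rewrite invr_ge0.
Qed.

Lemma adjmx_tens m n p q (A : 'M[C]_(m, n)) (B : 'M[C]_(p, q)) :
  adjmx (tensmx A B) = tensmx (adjmx A) (adjmx B).
Proof. by rewrite /adjmx /entconjmx map_mxT trmx_tens. Qed.

Lemma tensmx1 m n : tensmx (1%:M : 'M[C]_m) (1%:M : 'M[C]_n) = 1%:M.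
Proof.
apply/matrixP => i j; case: (mxtens_indexP i) => i1 i2; case: (mxtens_indexP j) => j1 j2.
rewrite tensmxE !mxE (can_eq (@mxtens_indexK _ _)) xpair_eqE.
by case: eqP; case: eqP => //= _ _; rewrite ?mulr1 ?mul0r ?mulr0.
Qed.

(** Expanding the state gives the double sum of [A u t * B u t]: Alice's operator moves to Bob's
    side by transposition. *)
Lemma braket_maxent d (A B : 'M[C]_d) :
  braket (maxent d) (tensmx A B) = (d%:R^-1)%:C * \tr (A^T *m B).
Proof.
rewrite /braket /maxent; set s := (Num.sqrt _)^-1.
rewrite adjmxZ -scalemxAr -!scalemxAl scalerA mxE -rmorphM.
have -> : s * s = d%:R^-1 by rewrite -invfM -expr2 sqr_sqrtr.
congr (_ * _); rewrite adjmx_sum !mulmx_suml summxE.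
transitivity (\sum_u \sum_t A u t * B u t); last first.
  rewrite exchange_big; apply: eq_bigr => t _; rewrite mxE.
  by apply: eq_bigr => u _; rewrite mxE.
apply: eq_bigr => u _; rewrite mulmx_sumr summxE; apply: eq_bigr => t _.
pose e v : 'cV[C]_d := delta_mx v 0.
have E (X : 'M[C]_d) : adjmx (e u) *m X *m e t = (X u t)%:M.
  rewrite /adjmx /entconjmx map_delta_mx trmx_delta -rowE -colE.
  by apply/matrixP => i j; rewrite !mxE !ord1 eqxx.
rewrite -!/(e _) (adjmx_tens (e u) (e u)).
rewrite (tensmx_mul (adjmx (e u)) (adjmx (e u)) A B).
rewrite (tensmx_mul (adjmx (e u) *m A) (adjmx (e u) *m B) (e t) (e t)) !E.
by rewrite !mxE !ord1 !eqxx.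
Qed.

Lemma Re_braket_maxent d (A B : 'M[C]_d) :
  Re (braket (maxent d) (tensmx (entconjmx A) B)) = nip A B.
Proof. by rewrite braket_maxent Re_scale mulrC. Qed.

Lemma nip11 d : (0 < d)%N -> nip (1%:M : 'M[C]_d) 1%:M = 1.
Proof. by move=> d0; rewrite -fnorm_sqr fnorm1 // expr1n. Qed.

Lemma vnorm_maxent d : (0 < d)%N -> vnorm (@maxent R d) = 1.
Proof.
move=> d0; rewrite /vnorm -[X in (X *m _)](mulmx1) -[in X in (_ *m X *m _)]tensmx1.
rewrite -/(braket _ _).
have E1 : (1%:M : 'M[C]_d) = entconjmx 1%:M by rewrite /entconjmx map_mx1.
by rewrite [X in tensmx X _]E1 Re_braket_maxent nip11 ?sqrtr1.
Qed.

(** Idempotence and cyclicity of the trace turn the trace of [P Q] into a squared norm; this makes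
    the losing probability quadratic in the defect. *)
Lemma nip_proj d (P Q : 'M[C]_d) : is_proj P -> is_proj Q ->
  nip P Q = fnorm (P *m Q) ^+ 2.
Proof.
move=> [PP Pa] [QQ Qa]; rewrite fnorm_sqr !nipE; congr (_ / _).
by rewrite hsip_mull Pa mulmxA PP [RHS]hsip_sym hsip_mulr Qa QQ.
Qed.

(** For each pair of inputs the correlations over all answer pairs sum to 1, so only losing terms
    are subtracted: at most [#|A|] squared of them, each at most [e ^+ 2]. *)
Lemma win_prob_maxent_ge (I A : finType) (eta : I -> I -> R)
  (V : A -> A -> I -> I -> bool) d (Q : I -> A -> 'M[C]_d) (e : R) :
  (0 < d)%N -> is_distr eta -> (forall i, is_pvm (Q i)) ->
  (forall i j a b, V a b i j = false -> fnorm (Q i a *m Q j b) <= e) ->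
  1 - #|A|%:R ^+ 2 * e ^+ 2 <=
    win_prob eta V (fun i a => entconjmx (Q i a)) Q (maxent d).
Proof.
move=> d0 [eta0 eta1] Qp small; rewrite /win_prob.
have key i : \sum_j eta i j - \sum_j #|A|%:R ^+ 2 * e ^+ 2 * eta i j <=
    Re (\sum_j (eta i j)%:C * \sum_a \sum_b (V a b i j)%:R *
      braket (maxent d) (tensmx (entconjmx (Q i a)) (Q j b))).
  rewrite -sumrB Re_sum; apply: ler_sum => j _; rewrite Re_scale.
  rewrite [_ * eta i j]mulrC -[X in X - _]mulr1 -mulrBr ler_wpM2l //.
  have tot : \sum_a \sum_b nip (Q i a) (Q j b) = 1.
    under eq_bigr do rewrite -nip_sumr.
    by rewrite -nip_suml (Qp i).2 (Qp j).2 nip11.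
  have cnt : \sum_(a : A) \sum_(b : A) e ^+ 2 = #|A|%:R ^+ 2 * e ^+ 2.
    by rewrite !sumr_const -mulrnA -[LHS]mulr_natl natrM -expr2.
  rewrite -cnt -[X in X - _]tot -sumrB Re_sum; apply: ler_sum => a _.
  rewrite -sumrB Re_sum; apply: ler_sum => b _.
  have -> (v : bool) (z : C) : Re (v%:R * z) = v%:R * Re z by case: v; rewrite ?mul1r ?mul0r.
  rewrite Re_braket_maxent; case Vab : (V a b i j).
    by rewrite mul1r lerBlDr lerDl sqr_ge0.
  rewrite mul0r subr_le0 nip_proj; [|exact: (Qp i).1|exact: (Qp j).1].
  rewrite ler_pXn2r ?nnegrE ?fnorm_ge0 ?(small i j) //.
  by rewrite (le_trans _ (small i j a b Vab)) ?fnorm_ge0.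
have -> : 1 - #|A|%:R ^+ 2 * e ^+ 2 =
    \sum_i (\sum_j eta i j - \sum_j #|A|%:R ^+ 2 * e ^+ 2 * eta i j).
  rewrite sumrB eta1; under [in RHS]eq_bigr do rewrite -mulr_sumr.
  by rewrite -mulr_sumr eta1 mulr1.
by rewrite Re_sum; apply: ler_sum => i _; exact: key.
Qed.
End MaxEnt.

(** * Synchronous games *)

Section AlmostRepresentations.
Context {R : realType} {S : Type}.
Local Notation C := (R[i]).

(* Constants independent of the dimension and of the representation are
   obtained by working over the type of all almost representations at once. *)
Record almost_rep (rels : @sterm R S -> Prop) (K : R) := AlmostRep {
  ar_dim : nat;
  ar_map : S -> 'M[C]_ar_dim;
  ar_err : R;
  ar_err_ge0 : 0 <= ar_err;
  ar_dim_gt0 : (0 < ar_dim)%N;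
  ar_eps_rep : eps_rep rels (@fnorm R ar_dim) ar_map ar_err;
  ar_opnorm : forall s, opnorm (ar_map s) <= K }.

Variables (rels : @sterm R S -> Prop) (K : R).
Local Notation T := (almost_rep rels K).
Local Notation approx := (approx (@ar_err rels K)).

Definition ar_eval (u : @sterm R S) (t : T) : 'M[C]_(ar_dim t) := seval (ar_map t) u.

Lemma ubounded_gen s : ubounded (fun t : T => ar_map t s).
Proof.
by exists K => t; apply: opnorm_op_le; [exact: ar_dim_gt0 | exact: ar_opnorm].
Qed.

Lemma approx_rel u : rels u -> approx (ar_eval u) (fun t => 0).
Proof.
by move=> ru; exists 1 => [//|t]; rewrite subr0 mul1r; exact: ar_eps_rep.
Qed.

Lemma approx_rel_sub u v : rels (ssub u v) -> approx (ar_eval u) (ar_eval v).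
Proof.
move=> /approx_rel [c c0 h]; exists c => [//|t]; have := h t.
rewrite subr0 /ar_eval /=; have -> : (-1 : C) = (-1)%:C by rewrite rmorphN1.
by rewrite rmorphN1 scaleN1r.
Qed.
End AlmostRepresentations.

Section CommonConstant.
Context {R : realType} {T : Type} (eps : T -> R) (d : T -> nat).
Hypothesis eps_ge0 : forall t, 0 <= eps t.

(** The constants of finitely many estimates are added along the enumeration of [I], giving one that
    serves them all. *)
Lemma approx_common (I : finType) (p : pred I) (F G : I -> forall t, 'M[R[i]]_(d t)) :
  (forall i, p i -> approx eps (F i) (G i)) ->
  exists2 c, 0 <= c & forall i t, p i -> fnorm (F i t - G i t) <= c * eps t.
Proof.
move=> h.
suff [c c0 k] : exists2 c, 0 <= c &
    forall i, i \in enum I -> forall t, p i -> fnorm (F i t - G i t) <= c * eps t.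
  by exists c => [//|i t]; apply: k; rewrite mem_enum.
elim: (enum I) => [|i s [c c0 IH]]; first by exists 0.
have [pi|npi] := boolP (p i); last first.
  exists c => [//|j]; rewrite inE => /orP[/eqP ->|js] t pj; first by rewrite pj in npi.
  exact: IH.
have [e e0 k] := h i pi; exists (c + e) => [|j]; first exact: addr_ge0.
rewrite inE => /orP[/eqP ->|js] t pj; rewrite mulrDl.
  by apply: (le_trans (k t)); rewrite lerDr mulr_ge0.
by apply: (le_trans (IH j js t pj)); rewrite lerDl mulr_ge0.
Qed.
End CommonConstant.

Section EvalLemmas.
Context {R : realType} {S : Type} {d : nat} (phi : S -> 'M[R[i]]_d).

Lemma seval_sbig (I : Type) (s : seq I) (f : I -> @sterm R S) :
  seval phi (sbig s f) = \sum_(i <- s) seval phi (f i).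
Proof.
elim: s => [|i s IH]; first by rewrite big_nil /= scale0r.
by rewrite big_cons -IH.
Qed.
End EvalLemmas.

Section SynchronousGames.
Context {R : realType}.
Local Notation C := (R[i]).

Theorem sync_stability (I A : finType) (eta : I -> I -> R)
    (V : A -> A -> I -> I -> bool) (K : R) :
  is_sync_game eta V ->
  exists (C eps0 : R), 0 < C /\ 0 < eps0 /\
  forall (eps : R) (d : nat), 0 <= eps -> eps <= eps0 -> (0 < d)%N ->
  forall phi : (I * A)%type -> 'M[R[i]]_d,
    eps_rep (sync_rel V) (@fnorm R d) phi eps ->
    (forall i a, opnorm (phi (i, a)) <= K) ->
    exists Q : I -> A -> 'M[R[i]]_d,
      (forall i, is_pvm (Q i)) /\
      (forall i a, fnorm (Q i a - phi (i, a)) <= C * eps) /\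
      1 - C * eps ^+ 2 <= win_prob eta V (fun i a => entconjmx (Q i a)) Q (@maxent R d).
Proof.
move=> [eta_distr [_ Vsync]].
have [i0|I0] := pickP I; last first.
  by case: eta_distr => _; rewrite big_pred0 // => /esym/eqP; rewrite oner_eq0.
have [a0 _|A0] := pickP A; last first.
  (* Without answers the sum relation evaluates to minus the identity, of norm 1, so no almost
     representation has error at most 1/2. *)
  exists 1, (2^-1); split=> //; split=> [|eps d eps0]; first by rewrite invr_gt0.
  move=> le_eps d0 phi phi_rep _.
  have := phi_rep _ (sync_sum V i0); rewrite /= seval_sbig.
  have -> : enum A = [::] by apply: size0nil; rewrite -cardT; apply: eq_card0.
  rewrite big_nil add0r.
  have -> : (-1 : C) = (-1)%:C by rewrite rmorphN1.
  rewrite fnormZ fnorm1 // normrN1 mulr1 => le1.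
  by have := le_trans le1 le_eps; lra.
pose T := almost_rep (sync_rel V) K.
pose P i a (t : T) := ar_map t (i, a).
have e0 (t : T) : 0 <= ar_err t := ar_err_ge0 t.
have Pb i a : ubounded (P i a) by exact: ubounded_gen.
have Psa i a : approx (@ar_err _ _ _ K) (P i a) (fun t => adjmx (P i a t)).
  exact: approx_rel_sub (sync_sa V i a).
have Porth0 i j a b : V a b i j = false ->
    approx (@ar_err _ _ _ K) (fun t => P i a t *m P j b t) (fun t => 0).
  by move=> Vab; exact: approx_rel (sync_orth Vab).
(* Distinct answers to one input are almost orthogonal because a synchronous game rejects them. *)
have Porth i a b : approx (@ar_err _ _ _ K) (fun t => P i a t *m P i b t)
    (fun t => if a == b then P i a t else 0).
  case: eqP => [<-|/eqP ab]; first exact: approx_rel_sub (sync_idem V i a).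
  exact/Porth0/Vsync.
have Psum i : approx (@ar_err _ _ _ K) (fun t => \sum_a P i a t) (fun t => 1%:M).
  have [c c0 h] := approx_rel_sub K (sync_sum V i).
  exists c => [//|t]; have := h t; rewrite /ar_eval seval_sbig /=.
  by rewrite big_enum.
pose Q i a t := round_pvm xpredT a0 (P i) a t.
have QP i a : approx (@ar_err _ _ _ K) (Q i a) (P i a).
  exact: (round_pvm_approx e0 isT (Pb i) (Psa i) (Porth i) (Psum i)).
have Qpvm i t : is_pvm (fun a => Q i a t) by exact: spectral_proj_pvm.
have Qb i a : ubounded (Q i a) by apply: ubounded_proj => t; exact: (Qpvm i t).1.
have Qorth i j a b : V a b i j = false ->
    approx (@ar_err _ _ _ K) (fun t => Q i a t *m Q j b t) (fun t => 0).
  move=> Vab; apply: approx_trans (Porth0 i j a b Vab) => //.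
  apply: (approx_trans (N := fun t => Q i a t *m P j b t)).
    by apply: approxMl.
  by apply: approxMr.
have [c1 c10 h1] := approx_common e0 (p := xpredT)
  (F := fun ia => Q ia.1 ia.2) (fun ia _ => QP ia.1 ia.2).
have [c2 c20 h2] := approx_common e0 (I := (I * I * (A * A))%type)
  (p := fun x => ~~ V x.2.1 x.2.2 x.1.1 x.1.2)
  (F := fun x t => Q x.1.1 x.2.1 t *m Q x.1.2 x.2.2 t)
  (fun x Vx => Qorth _ _ _ _ (negbTE Vx)).
(* [c1] covers the distance, the second summand the loss, and 1 makes the constant positive. *)
pose D := c1 + #|A|%:R ^+ 2 * c2 ^+ 2 + 1.
have D1 : c1 <= D by rewrite /D -addrA lerDl addr_ge0 // mulr_ge0 ?exprn_ge0.
have D2 : #|A|%:R ^+ 2 * c2 ^+ 2 <= D by rewrite /D addrAC lerDr addr_ge0.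
exists D, 1; split; first by rewrite ltr_wpDl // addr_ge0 // mulr_ge0 ?exprn_ge0.
split=> // eps d eps0 _ d0 phi phi_rep phi_K.
(* The given representation is one index of the family, so the uniform constants apply to it. *)
pose t : T := AlmostRep eps0 d0 phi_rep (fun s => let: (i, a) := s in phi_K i a).
exists (fun i a => Q i a t); split; first by move=> k; exact: (Qpvm k t).
split=> [k a|].
  by apply: (le_trans (h1 (k, a) t isT)); rewrite ler_wpM2r.
have := win_prob_maxent_ge (e := c2 * eps) d0 eta_distr (fun i => Qpvm i t).
move=> /(_ V) win; apply: le_trans (win _); last first.
  move=> k l a b Vab; have := h2 ((k, l), (a, b)) t; rewrite /= subr0; apply.
  by rewrite Vab.
by rewrite lerD2l lerN2 exprMn mulrA ler_wpM2r ?exprn_ge0.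
Qed.
End SynchronousGames.

(** * BCS games *)

Section OrderedProducts.
Context {R : realType}.
Local Notation C := (R[i]).

(** The fold mirrors [sprodl], so that evaluating a monomial yields it directly. *)
Definition mxprod {J : Type} {d} (s : seq J) (F : J -> 'M[C]_d) : 'M[C]_d :=
  foldr (fun j M => F j *m M) 1%:M s.

Lemma mxprodE (J : Type) d (s : seq J) (F : J -> 'M[C]_d) :
  mxprod s F = \prod_(j <- s) F j.
Proof. by elim: s => [|j s IH]; rewrite ?big_nil // big_cons -IH. Qed.

Lemma mxprod_cat (J : Type) d (s s' : seq J) (F : J -> 'M[C]_d) :
  mxprod (s ++ s') F = mxprod s F *m mxprod s' F.
Proof. by elim: s => [|j s IH]; rewrite /= ?mul1mx // IH mulmxA. Qed.

Lemma adjmx_mxprod (J : Type) d (s : seq J) (F : J -> 'M[C]_d) :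
  adjmx (mxprod s F) = mxprod (rev s) (fun j => adjmx (F j)).
Proof.
elim: s => [|j s IH]; first by rewrite adjmx1.
by rewrite rev_cons -cats1 mxprod_cat /= mulmx1 adjmxM IH.
Qed.

Lemma seval_sprodl (S J : Type) d (phi : S -> 'M[C]_d) (s : seq J) (f : J -> @sterm R S) :
  seval phi (sprodl s f) = mxprod s (fun j => seval phi (f j)).
Proof. by elim: s => //= j s ->. Qed.
End OrderedProducts.

(** * Joint spectral projections of almost commuting almost involutions *)

Section JointRounding.
Context {R : realType} {T : Type} (eps : T -> R) (d : T -> nat).
Hypothesis eps_ge0 : forall t, 0 <= eps t.
Local Notation C := (R[i]).
Local Notation family := (forall t, 'M[C]_(d t)).
Local Notation approx := (approx eps).
Local Notation sgnb := (@sgnb R).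

Lemma ubounded_mxprod (J : Type) (s : seq J) (F : J -> family) :
  (forall j, ubounded (F j)) -> ubounded (fun t => mxprod s (fun j => F j t)).
Proof. by move=> h; elim: s => [|j s IH]; [exact: ubounded1 | exact: uboundedM (h j) IH]. Qed.

(** [P] absorbs the factors one by one from the head of the list, each leaving its scalar, while the
    remaining product stays bounded. *)
Lemma approx_mxprod_eigen (J : eqType) (s : seq J) (F : J -> family) (c : J -> R) (P : family) :
  (forall j, ubounded (F j)) ->
  (forall j, j \in s -> approx (fun t => P t *m F j t) (fun t => (c j)%:C *: P t)) ->
  approx (fun t => P t *m mxprod s (fun j => F j t))
         (fun t => (\prod_(j <- s) c j)%:C *: P t).
Proof.
move=> Fb; elim: s => [|j s IH] h.
  by apply: approx_eq => t; rewrite big_nil mulmx1 rmorph1 scale1r.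
apply: (approx_trans (N := fun t => ((c j)%:C *: P t) *m mxprod s (fun j => F j t))).
  apply: (approx_trans (N := fun t => (P t *m F j t) *m mxprod s (fun j => F j t))).
    by apply: approx_eq => t; rewrite /= mulmxA.
  by apply: approxMr; [exact: eps_ge0 | exact: ubounded_mxprod | apply: h; exact: mem_head].
apply: (approx_trans (N := fun t => (c j)%:C *: (P t *m mxprod s (fun j => F j t)))).
  by apply: approx_eq => t; rewrite scalemxAl.
apply: approx_trans (approxZ (c j) (IH _)) _.
  by move=> k ks; apply: h; rewrite inE ks orbT.
by apply: approx_eq => t; rewrite big_cons rmorphM scalerA.
Qed.

Section Joint.
Variables (J : finType) (Z : J -> family).
Hypothesis Zb : forall j, ubounded (Z j).
Hypothesis Zsa : forall j, approx (Z j) (fun t => adjmx (Z j t)).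
Hypothesis Zsq : forall j, approx (fun t => Z j t *m Z j t) (fun t => 1%:M).
Hypothesis Zcomm : forall j k, approx (fun t => Z j t *m Z k t) (fun t => Z k t *m Z j t).

Definition half_proj (j : J) (b : bool) t : 'M[C]_(d t) :=
  (2^-1)%:C *: (1%:M + (sgnb b)%:C *: Z j t).

(** The factors commute only approximately, so this ordered product is only approximately a
    projection. *)
Definition joint_proj (x : {ffun J -> bool}) t : 'M[C]_(d t) :=
  mxprod (enum J) (fun j => half_proj j (x j) t).

Lemma ubounded_half_proj j b : ubounded (half_proj j b).
Proof. exact/uboundedZ/uboundedD/uboundedZ/Zb/ubounded1. Qed.

Lemma ubounded_joint_proj x : ubounded (joint_proj x).
Proof. by apply: ubounded_mxprod => j; exact: ubounded_half_proj. Qed.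

Lemma sgnb_sqr b : sgnb b * sgnb b = 1.
Proof. by case: b; rewrite /Defs.sgnb ?mulr1 // mulrNN mulr1. Qed.

Lemma half_proj_comm j k b :
  approx (fun t => Z k t *m half_proj j b t) (fun t => half_proj j b t *m Z k t).
Proof.
apply: (approx_trans (N := fun t =>
    (2^-1)%:C *: (Z k t + (sgnb b)%:C *: (Z k t *m Z j t)))).
  by apply: approx_eq => t; rewrite -scalemxAr mulmxDr mulmx1 -scalemxAr.
apply: (approx_trans (N := fun t =>
    (2^-1)%:C *: (Z k t + (sgnb b)%:C *: (Z j t *m Z k t)))).
  by apply/approxZ/approxD/approxZ/Zcomm/approx_refl.
by apply: approx_eq => t; rewrite -scalemxAl mulmxDl mul1mx -scalemxAl.
Qed.

Lemma mxprod_comm (s : seq J) (x : {ffun J -> bool}) k :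
  approx (fun t => mxprod s (fun j => half_proj j (x j) t) *m Z k t)
         (fun t => Z k t *m mxprod s (fun j => half_proj j (x j) t)).
Proof.
elim: s => [|j s IH]; first by apply: approx_eq => t; rewrite mul1mx mulmx1.
pose h t := half_proj j (x j) t; pose m t := mxprod s (fun j => half_proj j (x j) t).
apply: (approx_trans (N := fun t => h t *m (Z k t *m m t))).
  apply: (approx_trans (N := fun t => h t *m (m t *m Z k t))).
    by apply: approx_eq => t; rewrite /= mulmxA.
  apply: approxMl; [exact: eps_ge0 | exact: ubounded_half_proj | exact: IH].
apply: (approx_trans (N := fun t => (Z k t *m h t) *m m t)); last first.
  by apply: approx_eq => t; rewrite -mulmxA.
apply: (approx_trans (N := fun t => (h t *m Z k t) *m m t)).
  by apply: approx_eq => t; rewrite mulmxA.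
have mb : ubounded m by apply: ubounded_mxprod => i; exact: ubounded_half_proj.
by apply: approxMr; [exact: eps_ge0 | exact: mb | apply: approx_sym; exact: half_proj_comm].
Qed.

Lemma half_proj_eigen j b :
  approx (fun t => half_proj j b t *m Z j t) (fun t => (sgnb b)%:C *: half_proj j b t).
Proof.
apply: (approx_trans (N := fun t =>
    (2^-1)%:C *: (Z j t + (sgnb b)%:C *: (Z j t *m Z j t)))).
  by apply: approx_eq => t; rewrite -scalemxAl mulmxDl mul1mx -scalemxAl.
apply: (approx_trans (N := fun t => (2^-1)%:C *: (Z j t + (sgnb b)%:C *: 1%:M))).
  by apply/approxZ/approxD/approxZ/Zsq/approx_refl.
apply: approx_eq => t; rewrite scalerA mulrC -scalerA; congr (_ *: _).
by rewrite scalerDr scalerA -rmorphM sgnb_sqr scale1r addrC.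
Qed.

(** [Z j] is commuted leftwards past the later factors until it meets [half_proj j], which turns it
    into a sign. *)
Lemma joint_proj_eigen x j :
  approx (fun t => joint_proj x t *m Z j t) (fun t => (sgnb (x j))%:C *: joint_proj x t).
Proof.
rewrite /joint_proj; have : j \in enum J by rewrite mem_enum.
elim: (enum J) => // k s IH; rewrite inE.
pose h t := half_proj k (x k) t; pose m t := mxprod s (fun j => half_proj j (x j) t).
have mb : ubounded m by apply: ubounded_mxprod => i; exact: ubounded_half_proj.
have assoc : approx (fun t => (h t *m m t) *m Z j t) (fun t => h t *m (m t *m Z j t)).
  by apply: approx_eq => t; rewrite mulmxA.
have [js _|_] := boolP (j \in s).
  apply: approx_trans assoc _.
  apply: approx_trans (approxMl eps_ge0 (ubounded_half_proj k (x k)) (IH js)) _.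
  by apply: approx_eq => t; rewrite -scalemxAr.
rewrite orbF => /eqP jk; subst k; apply: approx_trans assoc _.
apply: approx_trans (approxMl eps_ge0 (ubounded_half_proj j (x j)) (mxprod_comm s x j)) _.
apply: (approx_trans (N := fun t => (h t *m Z j t) *m m t)).
  by apply: approx_eq => t; rewrite mulmxA.
apply: approx_trans (approxMr eps_ge0 mb (half_proj_eigen j (x j))) _.
by apply: approx_eq => t; rewrite -scalemxAl.
Qed.

Lemma joint_proj_half x j b :
  approx (fun t => joint_proj x t *m half_proj j b t)
         (fun t => (x j == b)%:R%:C *: joint_proj x t).
Proof.
apply: (approx_trans (N := fun t => (2^-1)%:C *: (joint_proj x t +
    (sgnb b)%:C *: (joint_proj x t *m Z j t)))).
  by apply: approx_eq => t; rewrite -scalemxAr mulmxDr mulmx1 -scalemxAr.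
apply: (approx_trans (N := fun t => (2^-1)%:C *: (joint_proj x t +
    (sgnb b)%:C *: ((sgnb (x j))%:C *: joint_proj x t)))).
  by apply/approxZ/approxD/approxZ/joint_proj_eigen/approx_refl.
apply: approx_eq => t; rewrite scalerA -rmorphM -{1}[joint_proj x t]scale1r -scalerDl.
rewrite -(rmorph1 (real_complex R)) -rmorphD scalerA -rmorphM; congr (_%:C *: _).
by case: (x j) b => [] []; rewrite /Defs.sgnb /=; field.
Qed.

(** The first projection absorbs each factor of the second with scalar 1 or 0 according to whether
    [x] and [y] agree there; distinct assignments differ somewhere, which kills the product. *)
Lemma joint_proj_orth x y :
  approx (fun t => joint_proj x t *m joint_proj y t)
         (fun t => if x == y then joint_proj x t else 0).
Proof.
apply: approx_trans (approx_mxprod_eigen (c := fun j => (x j == y j)%:R) _ _) _.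
- by move=> j; exact: ubounded_half_proj.
- by move=> j _; exact: joint_proj_half.
apply: approx_eq => t; case: eqP => [->|xy].
  by rewrite big1 ?rmorph1 ?scale1r // => j _; rewrite eqxx.
suff -> : \prod_(j <- enum J) (x j == y j)%:R = 0 :> R by rewrite scale0r.
have [j xyj] : exists j, x j != y j.
  by apply/existsP; apply: contra_notT xy => /existsPn xy; apply/ffunP => j; apply/eqP/negbNE/xy.
by rewrite big_enum (bigD1 j) //= (negbTE xyj) mul0r.
Qed.

(** The adjoint factors are close to the factors, so [P] absorbs them with scalar 1 and [P P^*] is
    close to [P]. Since [P P^*] is exactly self-adjoint, [P] is close to [P^*]. *)
Lemma joint_proj_sa x : approx (joint_proj x) (fun t => adjmx (joint_proj x t)).
Proof.
have PP : approx (fun t => joint_proj x t *m adjmx (joint_proj x t)) (joint_proj x).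
  apply: (approx_trans (N := fun t => joint_proj x t *m
      mxprod (rev (enum J)) (fun j => adjmx (half_proj j (x j) t)))).
    by apply: approx_eq => t; rewrite adjmx_mxprod.
  apply: approx_trans (approx_mxprod_eigen (F := fun j t => adjmx (half_proj j (x j) t))
    (c := fun=> 1) _ _) _.
  - by move=> j; apply: ubounded_adj; exact: ubounded_half_proj.
  - move=> j _; have := joint_proj_half x j (x j); rewrite eqxx; apply: approx_trans.
    apply: approxMl => //; first exact: ubounded_joint_proj.
    apply: (approx_trans (N := fun t => (2^-1)%:C *: (1%:M + (sgnb (x j))%:C *: adjmx (Z j t)))).
      by apply: approx_eq => t; rewrite adjmxZ adjmxD adjmx1 adjmxZ.
    by apply/approxZ/approxD/approxZ/approx_sym/Zsa/approx_refl.
  by apply: approx_eq => t; rewrite big1 // scale1r.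
apply: approx_trans (approx_sym PP) _.
apply: approx_trans (approx_adj PP).
by apply: approx_eq => t; rewrite adjmxM adjmxK.
Qed.

(** The distributive law respects the order of the factors, and the two half projections of each
    variable sum exactly to the identity. *)
Lemma joint_proj_sum t : \sum_x joint_proj x t = 1%:M.
Proof.
transitivity (\prod_(j : J) \sum_(b : bool) half_proj j b t).
  rewrite bigA_distr_bigA; apply: eq_bigr => x _.
  by rewrite /joint_proj mxprodE enumT [index_enum _]unlock.
rewrite big1 // => j _; rewrite big_bool /= /half_proj /Defs.sgnb -scalerDr.
rewrite rmorphN1 scaleN1r rmorph1 scale1r addrACA addNr addr0 -mulr2n -scaler_nat scalerA.
by rewrite -(rmorph_nat (real_complex R)) -rmorphM mulVf ?pnatr_eq0 // scale1r.
Qed.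

Variables (p : pred {ffun J -> bool}) (x0 : {ffun J -> bool}).
Hypothesis px0 : p x0.
Hypothesis Pout : forall x, ~~ p x -> approx (joint_proj x) (fun t => 0).

Definition joint_pvm (x : {ffun J -> bool}) t : 'M[C]_(d t) := round_pvm p x0 joint_proj x t.

(** Replace the rounded projections by [joint_proj x], whose signs come from multiplication by
    [Z j]; the sum over [x] then leaves [Z j]. *)
Lemma joint_pvm_sign j :
  approx (fun t => \sum_(x : {ffun J -> bool}) (sgnb (x j))%:C *: joint_pvm x t) (Z j).
Proof.
have QP x : approx (joint_pvm x) (joint_proj x).
  apply: (round_pvm_approx eps_ge0 px0) => //; first exact: ubounded_joint_proj.
  - exact: joint_proj_sa.
  - exact: joint_proj_orth.
  - by apply: approx_eq => t; exact: joint_proj_sum.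
apply: (approx_trans (N := fun t => \sum_x (joint_proj x t *m Z j t))).
  apply: approx_sum => // x _; apply: approx_trans (approxZ _ (QP x)) _.
  by apply: approx_sym; exact: joint_proj_eigen.
by apply: approx_eq => t; rewrite -mulmx_suml joint_proj_sum mul1mx.
Qed.
End Joint.
End JointRounding.

(** * Functional calculus for an exact projection-valued measure *)

Section PvmCombinations.
Context {R : realType} {A : finType} {d : nat} (Q : A -> 'M[R[i]]_d).
Hypothesis Qorth : forall a b, Q a *m Q b = if a == b then Q a else 0.
Hypothesis Qsa : forall a, adjmx (Q a) = Q a.
Hypothesis Qsum : \sum_a Q a = 1%:M.

Definition pvm_comb (u : A -> R) : 'M[R[i]]_d := \sum_a (u a)%:C *: Q a.

Lemma pvm_combM u v : pvm_comb u *m pvm_comb v = pvm_comb (fun a => u a * v a).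
Proof.
rewrite mulmx_suml; apply: eq_bigr => a _; rewrite mulmx_sumr (bigD1 a) //= big1.
  by rewrite addr0 -scalemxAl -scalemxAr Qorth eqxx scalerA rmorphM.
by move=> b ba; rewrite -scalemxAl -scalemxAr Qorth eq_sym (negbTE ba) !scaler0.
Qed.

(** Coefficients matter only where the projection is non-zero; this lets assignments with zero
    projection drop out of the constraint polynomial. *)
Lemma eq_pvm_comb u v : (forall a, Q a != 0 -> u a = v a) -> pvm_comb u = pvm_comb v.
Proof.
move=> uv; apply: eq_bigr => a _.
by have [->|/uv ->//] := eqVneq (Q a) 0; rewrite !scaler0.
Qed.

Lemma pvm_comb_const k : pvm_comb (fun=> k) = k%:C *: 1%:M.
Proof. by rewrite -Qsum scaler_sumr. Qed.

Lemma adjmx_pvm_comb u : adjmx (pvm_comb u) = pvm_comb u.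
Proof. by rewrite adjmx_sum; apply: eq_bigr => a _; rewrite adjmxZ Qsa. Qed.

Lemma pvm_comb_sa_unitary u : (forall a, u a * u a = 1) -> is_sa_unitary (pvm_comb u).
Proof.
move=> u1; have E : pvm_comb u *m pvm_comb u = 1%:M.
  rewrite pvm_combM -[RHS]scale1r -(rmorph1 (real_complex R)) -pvm_comb_const.
  by apply: eq_pvm_comb => a _; exact: u1.
by split; [exact: adjmx_pvm_comb | rewrite adjmx_pvm_comb].
Qed.

Lemma mxprod_pvm_comb (J : Type) (s : seq J) (u : J -> A -> R) :
  mxprod s (fun j => pvm_comb (u j)) = pvm_comb (fun a => \prod_(j <- s) u j a).
Proof.
elim: s => [|j s IH] /=.
  rewrite -[LHS]scale1r -(rmorph1 (real_complex R)) -pvm_comb_const.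
  by apply: eq_pvm_comb => a _; rewrite big_nil.
by rewrite IH pvm_combM; apply: eq_pvm_comb => a _; rewrite big_cons.
Qed.

Lemma pvm_comb_sum (I : Type) (s : seq I) (k : I -> R) (u : I -> A -> R) :
  \sum_(i <- s) (k i)%:C *: pvm_comb (u i) = pvm_comb (fun a => \sum_(i <- s) k i * u i a).
Proof.
under eq_bigr do rewrite scaler_sumr; rewrite exchange_big; apply: eq_bigr => a _.
rewrite rmorph_sum scaler_suml; apply: eq_bigr => i _.
by rewrite scalerA rmorphM.
Qed.
End PvmCombinations.

(** * Fourier inversion on the Boolean cube *)

Section Fourier.
Context {R : realType} {n m : nat}.
Variables (K : 'I_m -> {set 'I_n}) (sat : 'I_m -> {ffun 'I_n -> bool} -> bool).
Local Notation sgnb := (@sgnb R).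

Lemma sum_subset_prod (S : {set 'I_n}) (c : 'I_n -> R) :
  \sum_(al : {set 'I_n} | al \subset S) \prod_(j in al) c j = \prod_(j in S) (1 + c j).
Proof.
(* Outside [S] the factor is [0 + 1], so expanding over all indices kills every subset not contained
   in [S]. *)
transitivity (\prod_j ((if j \in S then c j else 0) + 1)); last first.
  rewrite [RHS]big_mkcond; apply: eq_bigr => j _.
  by case: ifP; rewrite ?add0r // addrC.
rewrite bigA_distr big_mkcond; apply: eq_bigr => al _; case: ifP => [alS|/negbT].
  rewrite big_mkcond; apply: eq_bigr => j _; case: ifP => // ja.
  by rewrite (fintype.subsetP alS).
case/fintype.subsetPn => j ja jS; rewrite (bigD1 j) //= ja (negbTE jS) mul0r //.
Qed.

(** Orthogonality of characters: the sum factors as the product of [1 + y_j x_j] over [S], which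
    vanishes once [x] and [y] differ; supported in [S], they can differ only there. *)
Lemma sum_chars (S : {set 'I_n}) (x y : {ffun 'I_n -> bool}) :
  assign_of S x -> assign_of S y ->
  \sum_(al : {set 'I_n} | al \subset S)
     (\prod_(j in al) sgnb (y j)) * (\prod_(j in al) sgnb (x j)) =
  if y == x then 2 ^+ #|S| else 0.
Proof.
move=> ax ay; under eq_bigr do rewrite -big_split /=.
rewrite sum_subset_prod; case: eqP => [->|yx].
  rewrite -prodr_const; apply: eq_bigr => j _.
  by case: (x j); rewrite /Defs.sgnb ?mulr1 // mulrNN mulr1.
have [j yxj] : exists j, y j != x j.
  by apply/existsP; apply: contra_notT yx => /existsPn yx; apply/ffunP => j; apply/eqP/negbNE/yx.
have jS : j \in S.
  apply: contraNT yxj => jS; move: (forallP ax j) (forallP ay j).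
  by rewrite jS /= => /negbTE -> /negbTE ->.
rewrite (bigD1 j) //=; suff -> : 1 + sgnb (y j) * sgnb (x j) = 0 by rewrite mul0r.
by move: yxj; case: (x j); case: (y j); rewrite // /Defs.sgnb ?mulr1 ?mul1r subrr.
Qed.

(** After exchanging the sums, orthogonality of characters leaves only the assignment [x], with a
    factor that cancels the normalisation. *)
Lemma fourier_inversion i (x : {ffun 'I_n -> bool}) : assign_of (K i) x ->
  \sum_(al <- [seq al : {set 'I_n} <- enum {set 'I_n} | al \subset K i])
     bcs_fhat K sat i al * \prod_(j <- [seq j <- enum 'I_n | j \in al]) sgnb (x j)
  = if sat i x then -1 else 1.
Proof.
move=> ax; rewrite big_filter big_enum_cond /=.
transitivity (\sum_(al : {set 'I_n} | al \subset K i) \sum_(y | assign_of (K i) y)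
   (2 ^+ #|K i|)^-1 * ((if sat i y then -1 else 1) *
   ((\prod_(j in al) sgnb (y j)) * (\prod_(j in al) sgnb (x j))))).
  apply: eq_bigr => al _; rewrite /bcs_fhat big_filter big_enum_cond /=.
  rewrite mulr_sumr mulr_suml; apply: eq_bigr => y _.
  by rewrite !mulrA.
rewrite exchange_big /= (bigD1 x) //= [X in _ + X]big1 => [|y /andP[ay yx]].
  rewrite -mulr_sumr -mulr_sumr sum_chars // eqxx addr0 mulrC mulfK //.
  by rewrite expf_neq0 // pnatr_eq0.
by rewrite -mulr_sumr -mulr_sumr sum_chars // (negbTE yx) !mulr0.
Qed.
End Fourier.

(** * Entrywise conjugation and correlations of observables *)

Section Conjugation.
Context {R : realType}.
Local Notation C := (R[i]).

Lemma entconjmxM m n p (A : 'M[C]_(m, n)) (B : 'M[C]_(n, p)) :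
  entconjmx (A *m B) = entconjmx A *m entconjmx B.
Proof. by rewrite /entconjmx map_mxM. Qed.

Lemma adjmx_entconjmx m n (A : 'M[C]_(m, n)) : adjmx (entconjmx A) = entconjmx (adjmx A).
Proof. by apply/matrixP => i j; rewrite !mxE. Qed.

Lemma entconjmx1 n : entconjmx (1%:M : 'M[C]_n) = 1%:M.
Proof. by rewrite /entconjmx map_mx1. Qed.

Lemma entconjmx_pvm_comb (A : finType) d (Q : A -> 'M[C]_d) u :
  entconjmx (pvm_comb Q u) = pvm_comb (fun a => entconjmx (Q a)) u.
Proof.
rewrite /pvm_comb /entconjmx raddf_sum; apply: eq_bigr => a _.
by apply/matrixP => i j; rewrite !mxE /= rmorphM /= oppr0.
Qed.

Lemma entconjmx_sa_unitary d (Y : 'M[C]_d) : is_sa_unitary Y -> is_sa_unitary (entconjmx Y).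
Proof.
case=> Ya [YY _]; rewrite Ya in YY.
by rewrite /is_sa_unitary adjmx_entconjmx Ya -entconjmxM YY entconjmx1.
Qed.

Lemma nip_isometry d (M : 'M[C]_d) : (0 < d)%N -> adjmx M *m M = 1%:M -> nip M M = 1.
Proof.
by move=> d0 MM; rewrite -(nip11 (R := R) d0) !nipE -{1}[M]mulmx1 hsip_mull MM.
Qed.

(** Expand the squared distance: both squared norms are 1. The loss is thus quadratic in the
    distance. *)
Lemma nip_sa_unitary d (Y X : 'M[C]_d) : (0 < d)%N ->
  is_sa_unitary Y -> is_sa_unitary X -> nip Y X = 1 - fnorm (Y - X) ^+ 2 / 2.
Proof.
move=> d0 [_ [YY _]] [_ [XX _]].
rewrite fnorm_sqr nipD (nip_sym (Y - X) Y) nipD (nip_sym (Y - X)) nipD.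
have nN (A B : 'M[C]_d) : nip A (- B) = - nip A B by rewrite !nipE hsipNr mulNr.
by rewrite !nN (nip_sym (- X) Y) (nip_sym (- X) X) !nN !nip_isometry //; field.
Qed.
End Conjugation.

(** * Rounding almost representations of a BCS algebra *)

Section BcsGames.
Context {R : realType}.
Local Notation C := (R[i]).
Local Notation sgnb := (@sgnb R).

Lemma approx_fix_eq0 (T : Type) (eps : T -> R) (d : T -> nat)
    (eps_ge0 : forall t, 0 <= eps t) (M : forall t, 'M[C]_(d t)) :
  approx eps M (fun t => - M t) -> approx eps M (fun t => 0).
Proof.
case=> c c0 h; exists c => [//|t]; apply: le_trans (h t).
rewrite subr0 opprK -mulr2n -scaler_nat -(rmorph_nat (real_complex R)) fnormZ normr_nat.
by rewrite ler_peMl ?fnorm_ge0 // ler1n.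
Qed.

Variables (n m : nat) (K : 'I_m -> {set 'I_n}).
Variables (sat : 'I_m -> {ffun 'I_n -> bool} -> bool) (Kb : R).
Local Notation T := (@almost_rep R 'I_n (bcs_rel K sat) Kb).
Local Notation approx := (approx (@ar_err _ _ (bcs_rel K sat) Kb)).
Let err_ge0 (t : T) : 0 <= ar_err t := ar_err_ge0 t.

Definition bcs_var (j : 'I_n) (t : T) : 'M[C]_(ar_dim t) := ar_map t j.

(** Variables outside the scope become the identity, so all indices of ['I_n] take part in the joint
    projections, and an assignment that is -1 outside the scope gets a small projection. *)
Definition bcs_local (i : 'I_m) (j : 'I_n) (t : T) : 'M[C]_(ar_dim t) :=
  if j \in K i then bcs_var j t else 1%:M.

Lemma bcs_var_sa j : approx (bcs_var j) (fun t => adjmx (bcs_var j t)).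
Proof. exact: approx_sym (approx_rel_sub Kb (bcs_sa K sat j)). Qed.

Lemma bcs_var_sqr j : approx (fun t => bcs_var j t *m bcs_var j t) (fun t => 1%:M).
Proof. by have := approx_rel_sub Kb (bcs_sq (R := R) K sat j); exact. Qed.

Lemma bcs_var_bounded j : ubounded (bcs_var j).
Proof. exact: (@ubounded_gen _ _ _ Kb j). Qed.

Lemma bcs_local_bounded i j : ubounded (bcs_local i j).
Proof.
by rewrite /bcs_local; case: (j \in K i); [exact: bcs_var_bounded | exact: ubounded1].
Qed.

Lemma bcs_local_sa i j : approx (bcs_local i j) (fun t => adjmx (bcs_local i j t)).
Proof.
rewrite /bcs_local; case: (j \in K i); first exact: bcs_var_sa.
by apply: approx_eq => t; rewrite adjmx1.
Qed.

Lemma bcs_local_sqr i j :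
  approx (fun t => bcs_local i j t *m bcs_local i j t) (fun t => 1%:M).
Proof.
rewrite /bcs_local; case: (j \in K i); first exact: bcs_var_sqr.
by apply: approx_eq => t; rewrite mul1mx.
Qed.

Lemma bcs_local_comm i j k : approx (fun t => bcs_local i j t *m bcs_local i k t)
  (fun t => bcs_local i k t *m bcs_local i j t).
Proof.
rewrite /bcs_local; case ji: (j \in K i); case ki: (k \in K i).
- by have := approx_rel_sub Kb (bcs_comm (R := R) sat ji ki); exact.
- by apply: approx_eq => t; rewrite mul1mx mulmx1.
- by apply: approx_eq => t; rewrite mul1mx mulmx1.
- exact: approx_refl.
Qed.

Definition bcs_proj i x (t : T) : 'M[C]_(ar_dim t) := joint_proj (bcs_local i) x t.

Definition bcs_valid i x := assign_of (K i) x && sat i x.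

Lemma bcs_proj_eigen i x j : j \in K i ->
  approx (fun t => bcs_proj i x t *m bcs_var j t)
         (fun t => (sgnb (x j))%:C *: bcs_proj i x t).
Proof.
move=> ji; have := joint_proj_eigen err_ge0 (bcs_local_bounded i) (bcs_local_sqr i)
  (bcs_local_comm i) x j.
by apply: approx_trans; apply: approx_eq => t; rewrite /bcs_local ji.
Qed.

(** The projection absorbs every monomial from the left, which evaluates the constraint polynomial
    at [x]; Fourier inversion gives the value. *)
Lemma bcs_proj_constraint i x : assign_of (K i) x ->
  approx (fun t => bcs_proj i x t *m ar_eval (bcs_fterm K sat i) t)
         (fun t => (if sat i x then -1 else 1 : R)%:C *: bcs_proj i x t).
Proof.
move=> ax.
pose supp (al : {set 'I_n}) := [seq j <- enum 'I_n | j \in al].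
pose als := [seq al : {set 'I_n} <- enum {set 'I_n} | al \subset K i].
have h : approx (fun t => \sum_(al <- als) (bcs_fhat K sat i al)%:C *:
      (bcs_proj i x t *m mxprod (supp al) (fun j => bcs_var j t)))
    (fun t => \sum_(al <- als) (bcs_fhat K sat i al)%:C *:
      ((\prod_(j <- supp al) sgnb (x j))%:C *: bcs_proj i x t)).
  rewrite /als; apply: (approx_trans (N := fun t => \sum_(al <- enum {set 'I_n} | al \subset K i)
    (bcs_fhat K sat i al)%:C *:
      (bcs_proj i x t *m mxprod (supp al) (fun j => bcs_var j t)))).
    by apply: approx_eq => t; rewrite big_filter.
  apply: (approx_trans (N := fun t => \sum_(al <- enum {set 'I_n} | al \subset K i)
    (bcs_fhat K sat i al)%:C *:
      ((\prod_(j <- supp al) sgnb (x j))%:C *: bcs_proj i x t))); last first.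
    by apply: approx_eq => t; rewrite big_filter.
  apply: approx_sum => al alK; apply: approxZ.
  apply: (approx_mxprod_eigen err_ge0); first exact: bcs_var_bounded.
  move=> j; rewrite mem_filter => /andP[jal _]; apply: bcs_proj_eigen.
  exact: (fintype.subsetP alK).
apply: (approx_trans (N := fun t => \sum_(al <- als) (bcs_fhat K sat i al)%:C *:
      (bcs_proj i x t *m mxprod (supp al) (fun j => bcs_var j t)))).
  apply: approx_eq => t; rewrite /ar_eval seval_sbig mulmx_sumr.
  by apply: eq_bigr => al _; rewrite /= seval_sprodl scalemxAr.
apply: approx_trans h _; apply: approx_eq => t.
rewrite -(fourier_inversion (R := R) sat ax) rmorph_sum scaler_suml.
by apply: eq_bigr => al _; rewrite /= scalerA -rmorphM.
Qed.

(** In both cases the projection is close to its own negative. A violating assignment has polynomial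
    value 1 where the relation says -1; an assignment not supported in the scope gives eigenvalue -1
    to the identity. *)
Lemma bcs_proj_invalid i x : ~~ bcs_valid i x -> approx (bcs_proj i x) (fun t => 0).
Proof.
have Pb : ubounded (bcs_proj i x) by apply: ubounded_joint_proj; exact: bcs_local_bounded.
rewrite /bcs_valid; have [ax /= nsat|/forallPn[j]] := boolP (assign_of _ _).
  apply: approx_fix_eq0 => //; have := bcs_proj_constraint ax; rewrite (negbTE nsat).
  move=> /approx_sym h.
  apply: (approx_trans (N := fun t => (1 : R)%:C *: bcs_proj i x t)).
    by apply: approx_eq => t; rewrite rmorph1 scale1r.
  apply: approx_trans h _.
  apply: approx_trans (approxMl err_ge0 Pb (approx_rel_sub Kb (bcs_f (R := R) K sat i))) _.
  apply: approx_eq => t; rewrite /ar_eval /=.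
  by rewrite -scalemxAr mulmx1 scaleN1r.
rewrite negb_imply negbK => /andP[jK xj] _; apply: approx_fix_eq0 => //.
have := joint_proj_eigen err_ge0 (bcs_local_bounded i) (bcs_local_sqr i)
  (bcs_local_comm i) x j.
rewrite xj => h; apply: approx_trans (approx_trans h _).
  by apply: approx_eq => t; rewrite /bcs_local (negbTE jK) mulmx1.
by apply: approx_eq => t; rewrite /Defs.sgnb rmorphN1 scaleN1r.
Qed.

(** All joint projections would be small although they sum exactly to the identity, so an
    unsatisfiable constraint bounds the error from below. *)
Lemma bcs_unsat_err i : (forall x, ~~ bcs_valid i x) ->
  exists2 c, 0 <= c & forall t : T, 1 <= c * ar_err t.
Proof.
move=> unsat.
have [c c0 h] : approx (fun t => \sum_x bcs_proj i x t) (fun t => 0).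
  by apply: approx_sum0 => x _; exact: bcs_proj_invalid.
by exists c => [//|t]; have := h t; rewrite joint_proj_sum subr0 fnorm1 // ar_dim_gt0.
Qed.

Variable x0 : 'I_m -> {ffun 'I_n -> bool}.
Hypothesis x0_valid : forall i, bcs_valid i (x0 i).

(** All observables for constraint [i] are read off one exact measure on assignments, so they
    commute exactly. *)
Definition bcs_alice (i : 'I_m) (j : 'I_n) (t : T) : 'M[C]_(ar_dim t) :=
  pvm_comb (fun x => joint_pvm (bcs_local i) (bcs_valid i) (x0 i) x t)
    (fun x : {ffun 'I_n -> bool} => sgnb (x j)).

Definition bcs_bob (j : 'I_n) (t : T) : 'M[C]_(ar_dim t) := sign_mx (bcs_var j t).

Lemma bcs_bob_approx j : approx (bcs_bob j) (bcs_var j).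
Proof.
exact: (sign_mx_approx err_ge0 (bcs_var_bounded j) (bcs_var_sa j) (bcs_var_sqr j)).
Qed.

(** Both approximate the same generator: Alice by the joint rounding of constraint [i], Bob by the
    sign. *)
Lemma bcs_alice_bob i j : j \in K i -> approx (bcs_alice i j) (bcs_bob j).
Proof.
move=> ji; apply: approx_trans (approx_sym (bcs_bob_approx j)).
have := joint_pvm_sign err_ge0 (bcs_local_bounded i) (bcs_local_sa i) (bcs_local_sqr i)
  (bcs_local_comm i) (x0_valid i) (@bcs_proj_invalid i) j.
move=> h; apply: approx_trans h _.
by apply: approx_eq => t; rewrite /bcs_local ji.
Qed.

Lemma bcs_alice_sa_unitary i j t : is_sa_unitary (bcs_alice i j t).
Proof.
apply: pvm_comb_sa_unitary.
- by move=> x y; exact: spectral_projM.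
- by move=> x; exact: adjmx_fcalc.
- exact: (spectral_proj_pvm _ _).2.
- by move=> x; exact: sgnb_sqr.
Qed.

Lemma bcs_rounded_strategy t : is_bcs_strategy K sat
  (fun i j => entconjmx (bcs_alice i j t)) (fun j => bcs_bob j t) (@maxent R (ar_dim t)).
Proof.
pose Q i x := entconjmx (joint_pvm (bcs_local i) (bcs_valid i) (x0 i) x t).
have Qorth i x y : Q i x *m Q i y = if x == y then Q i x else 0.
  rewrite -entconjmxM /Q /joint_pvm /round_pvm spectral_projM.
  by case: eqP => // _; rewrite /entconjmx map_mx0.
have Qsum i : \sum_x Q i x = 1%:M.
  rewrite -entconjmx1 -(spectral_proj_pvm (nearest (bcs_valid i) (x0 i))
    (label_mx (joint_proj (bcs_local i)) t)).2.
  by rewrite /Q /entconjmx raddf_sum.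
have YE i j : entconjmx (bcs_alice i j t) = pvm_comb (Q i) (fun x => sgnb (x j)).
  exact: entconjmx_pvm_comb.
split=> [i j _|].
  exact/entconjmx_sa_unitary/bcs_alice_sa_unitary.
split=> [i j j' _ _|].
  rewrite !YE !pvm_combM //; apply: eq_pvm_comb => x _; exact: mulrC.
split=> [i|]; last split=> [j|].
- rewrite seval_sbig.
  transitivity (\sum_(al <- [seq al : {set 'I_n} <- enum {set 'I_n} | al \subset K i])
    (bcs_fhat K sat i al)%:C *: pvm_comb (Q i) (fun x =>
      \prod_(j <- [seq j <- enum 'I_n | j \in al]) sgnb (x j))).
    apply: eq_bigr => al _ /=; congr (_ *: _); rewrite seval_sprodl /=.
    rewrite -(mxprod_pvm_comb (Qorth i) (Qsum i)) /mxprod.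
    by elim: [seq j <- _ | _] => //= j s ->; rewrite YE.
  (* Invalid assignments have zero projection, and on valid ones the polynomial equals -1, so the
     constraint holds exactly. *)
  rewrite pvm_comb_sum (eq_pvm_comb (v := fun=> -1)); last first.
    move=> x Qx; have : bcs_valid i x.
      by apply: contraNT Qx => nv; rewrite /Q /joint_pvm round_pvm_out // /entconjmx map_mx0.
    by case/andP=> ax sx; rewrite fourier_inversion // sx.
  by rewrite pvm_comb_const // rmorphN1 scaleN1r.
- exact: sign_mx_sa_unitary.
- by apply: vnorm_maxent; exact: ar_dim_gt0.
Qed.

Lemma bcs_rounded_win (eta : 'I_m -> 'I_n -> R) : is_distr eta ->
  exists2 c, 0 <= c & forall t : T, 1 - c * ar_err t ^+ 2 <=
    bcs_win_prob eta K (fun i j => entconjmx (bcs_alice i j t)) (fun j => bcs_bob j t)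
      (@maxent R (ar_dim t)).
Proof.
move=> [eta0 eta1].
have [c c0 h] := approx_common err_ge0 (I := ('I_m * 'I_n)%type)
  (p := fun ij => ij.2 \in K ij.1) (F := fun ij => bcs_alice ij.1 ij.2)
  (fun ij => @bcs_alice_bob ij.1 ij.2).
exists (c ^+ 2); first exact: exprn_ge0.
move=> t; rewrite /bcs_win_prob.
have -> : 1 - c ^+ 2 * ar_err t ^+ 2 =
    \sum_i \sum_j eta i j * (1 - c ^+ 2 * ar_err t ^+ 2).
  by under eq_bigr do rewrite -mulr_suml; rewrite -mulr_suml eta1 mul1r.
apply: ler_sum => i _; apply: ler_sum => j _; apply: ler_wpM2l => //.
have e0 := err_ge0 t.
case: ifP => ji; last by rewrite lerBlDr lerDl mulr_ge0 // exprn_ge0.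
rewrite Re_braket_maxent nip_sa_unitary ?ar_dim_gt0 //; last first.
- exact: sign_mx_sa_unitary.
- exact: bcs_alice_sa_unitary.
have : fnorm (bcs_alice i j t - bcs_bob j t) ^+ 2 <= c ^+ 2 * ar_err t ^+ 2.
  rewrite -exprMn ler_pXn2r ?nnegrE ?fnorm_ge0 ?mulr_ge0 //.
  exact: (h (i, j) t ji).
have : 0 <= fnorm (bcs_alice i j t - bcs_bob j t) ^+ 2 by rewrite sqr_ge0.
by move: (_ ^+ 2) (c ^+ 2 * _) => u v; lra.
Qed.
End BcsGames.

Section BcsTheorem.
Context {R : realType}.

Theorem bcs_stability (n m : nat) (K : 'I_m -> {set 'I_n})
    (sat : 'I_m -> {ffun 'I_n -> bool} -> bool) (eta : 'I_m -> 'I_n -> R) (Kb : R) :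
  is_distr eta ->
  exists (C eps0 : R), 0 < C /\ 0 < eps0 /\
  forall (eps : R) (d : nat), 0 <= eps -> eps <= eps0 -> (0 < d)%N ->
  forall phi : 'I_n -> 'M[R[i]]_d,
    eps_rep (bcs_rel K sat) (@fnorm R d) phi eps ->
    (forall j, opnorm (phi j) <= Kb) ->
    exists (Y : 'I_m -> 'I_n -> 'M[R[i]]_d) (X : 'I_n -> 'M[R[i]]_d),
      is_bcs_strategy K sat Y X (@maxent R d) /\
      (forall j, fnorm (X j - phi j) <= C * eps) /\
      1 - C * eps ^+ 2 <= bcs_win_prob eta K Y X (@maxent R d).
Proof.
move=> eta_distr.
have [all_sat|/forallPn[i /existsPn unsat]] :=
    boolP [forall i, [exists x, bcs_valid K sat i x]]; last first.
  have [c c0 h] := bcs_unsat_err Kb unsat.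
  (* With [eps] at most [1 / (2 c + 1)] the lower bound [1 <= c * eps] is impossible, so the claim
     is vacuous. *)
  exists 1, (c + c + 1)^-1; split=> //; split=> [|eps d eps_ge0 le_eps d0 phi phi_rep phi_K].
    by rewrite invr_gt0; lra.
  have := h (AlmostRep eps_ge0 d0 phi_rep phi_K); rewrite /=.
  have cp : 0 < c + c + 1 by lra.
  move: le_eps; rewrite -[_^-1]mul1r ler_pdivlMr //.
  by move=> ? ?; exfalso; nra.
have valid i : exists x, bcs_valid K sat i x by exact/existsP/(forallP all_sat).
have [x0 x0_valid] := fin_all_exists valid.
have [c1 c10 h1] := approx_common (fun t => ar_err_ge0 t) (p := xpredT)
  (fun j _ => bcs_bob_approx K sat Kb j).
have [c2 c20 h2] := bcs_rounded_win Kb x0_valid eta_distr.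
exists (c1 + c2 + 1), 1; split; first by rewrite ltr_wpDl // addr_ge0.
split=> // eps d eps_ge0 _ d0 phi phi_rep phi_K.
pose t := AlmostRep eps_ge0 d0 phi_rep phi_K.
exists (fun i j => entconjmx (bcs_alice x0 i j t)), (fun j => bcs_bob j t).
split; first exact: (bcs_rounded_strategy x0_valid t).
split=> [j|].
  apply: (le_trans (h1 j t isT)); rewrite ler_wpM2r // -addrA lerDl.
  by rewrite addr_ge0.
apply: le_trans (h2 t); rewrite lerD2l lerN2 ler_wpM2r ?exprn_ge0 //.
by rewrite addrAC lerDr addr_ge0.
Qed.
End BcsTheorem.

(** * XOR games *)

Section XorGames.
Context {R : realType}.
Local Notation C := (R[i]).

Lemma xor_bias_maxent m n (g : 'I_m -> 'I_n -> R) d (Y : 'I_m -> 'M[C]_d)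
    (X : 'I_n -> 'M[C]_d) :
  xor_bias g (fun i => entconjmx (Y i)) X (maxent d) =
  \sum_i nip (Y i) (\sum_j (g i j)%:C *: X j).
Proof.
rewrite /xor_bias Re_sum; apply: eq_bigr => i _.
rewrite Re_sum nip_sumr; apply: eq_bigr => j _.
by rewrite Re_scale Re_braket_maxent nipZr.
Qed.

(** The bias is compared with the sum of the [c i]; that this is the optimal bias is a separate
    matter, settled by [sum_marginal_row_biases]. *)
Theorem xor_stability (m n : nat) (g : 'I_m -> 'I_n -> R) (c : 'I_m -> R) (K : R) :
  (forall i, c i != 0) ->
  exists (C eps0 : R), 0 < C /\ 0 < eps0 /\
  forall (eps : R) (d : nat), 0 <= eps -> eps <= eps0 -> (0 < d)%N ->
  forall phi : 'I_n -> 'M[R[i]]_d,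
    eps_rep (xor_rel g c) (@fnorm R d) phi eps ->
    (forall j, opnorm (phi j) <= K) ->
    exists (Y : 'I_m -> 'M[R[i]]_d) (X : 'I_n -> 'M[R[i]]_d),
      is_xor_strategy Y X (@maxent R d) /\
      (forall j, fnorm (X j - phi j) <= C * eps) /\
      \sum_i c i - C * eps <= xor_bias g Y X (@maxent R d).
Proof.
move=> c0.
pose T := @almost_rep R 'I_n (xor_rel g c) K.
pose P j (t : T) := ar_map t j.
have e0 (t : T) : 0 <= ar_err t := ar_err_ge0 t.
have Pb j : ubounded (P j) by exact: ubounded_gen.
have Psa j : approx (@ar_err _ _ _ K) (P j) (fun t => adjmx (P j t)).
  by have := approx_rel_sub K (xor_sa (R := R) g c j); exact.
have Psq j : approx (@ar_err _ _ _ K) (fun t => P j t *m P j t) (fun t => 1%:M).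
  by have := approx_rel_sub K (xor_sq (R := R) g c j); exact.
pose B i (t : T) := \sum_j (g i j)%:C *: P j t.
have Bsq i : approx (@ar_err _ _ _ K) (fun t => B i t *m B i t)
    (fun t => (c i ^+ 2)%:C *: 1%:M).
  have [k k0 h] := approx_rel_sub K (xor_row (R := R) g c i).
  exists k => [//|t]; have := h t; rewrite /ar_eval /= !seval_sbig /= big_enum.
  exact.
pose X j (t : T) := sign_mx (P j t).
have XP j : approx (@ar_err _ _ _ K) (X j) (P j).
  exact: (sign_mx_approx e0 (Pb j) (Psa j) (Psq j)).
have Xu j t : is_sa_unitary (X j t) by exact: sign_mx_sa_unitary.
have Xb j : ubounded (X j) by apply: ubounded_sa_unitary => t.
pose A i (t : T) := \sum_j (g i j)%:C *: X j t.
have AB i : approx (@ar_err _ _ _ K) (A i) (B i).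
  by apply: approx_sum => j _; apply: approxZ; exact: XP.
have Ab i : ubounded (A i) by apply: ubounded_sum => j; exact/uboundedZ/Xb.
have Bb i : ubounded (B i) by apply: ubounded_sum => j; exact/uboundedZ/Pb.
(* The row relation makes the square of [A i] close to [c i ^+ 2], so after division by [c i] the
   row is almost an involution. *)
pose N i (t : T) := (c i)^-1%:C *: A i t.
have Nb i : ubounded (N i) by exact/uboundedZ/Ab.
have Nsa i t : adjmx (N i t) = N i t.
  rewrite adjmxZ adjmx_sum; congr (_ *: _); apply: eq_bigr => j _.
  by rewrite adjmxZ (Xu j t).1.
have Nsq i : approx (@ar_err _ _ _ K) (fun t => N i t *m N i t) (fun t => 1%:M).
  apply: (approx_trans (N := fun t => ((c i)^-1 ^+ 2)%:C *: (A i t *m A i t))).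
    by apply: approx_eq => t; rewrite -scalemxAl -scalemxAr scalerA -rmorphM.
  apply: (approx_trans (N := fun t => ((c i)^-1 ^+ 2)%:C *: ((c i ^+ 2)%:C *: 1%:M))).
    apply: approxZ; apply: approx_trans (approxMl e0 (Ab i) (AB i)) _.
    exact: approx_trans (approxMr e0 (Bb i) (AB i)) (Bsq i).
  apply: approx_eq => t; rewrite scalerA -rmorphM -exprMn mulVf //.
  by rewrite expr1n rmorph1 scale1r.
pose Y i (t : T) := sign_mx (N i t).
have Yu i t : is_sa_unitary (Y i t) by exact: sign_mx_sa_unitary.
have YN i : approx (@ar_err _ _ _ K) (N i) (Y i).
  apply: approx_sym; apply: (sign_mx_approx e0 (Nb i) _ (Nsq i)).
  by apply: approx_eq => t; rewrite Nsa.
have [k1 k10 h1] := approx_common e0 (p := xpredT) (fun j _ => XP j).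
have [k2 k20 h2] := approx_common e0 (p := xpredT) (fun i _ => YN i).
(* [k1] bounds the rounding of Bob's observables; row [i] loses at most [|c i| * k2 * eps]. *)
pose D := k1 + (\sum_i `|c i|) * k2 + 1.
have S0 : 0 <= (\sum_i `|c i|) * k2 by rewrite mulr_ge0 // sumr_ge0.
exists D, 1; split; first by rewrite ltr_wpDl // addr_ge0.
split=> // eps d eps0 _ d0 phi phi_rep phi_K.
pose t : T := AlmostRep eps0 d0 phi_rep phi_K.
exists (fun i => entconjmx (Y i t)), (fun j => X j t); split; last split.
- split=> [i|]; first exact: (entconjmx_sa_unitary (Yu i t)).
  by split=> [j|]; [exact: (Xu j t) | exact: vnorm_maxent].
- move=> j; apply: (le_trans (h1 j t isT)); rewrite ler_wpM2r // /D -addrA lerDl.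
  by rewrite addr_ge0.
rewrite xor_bias_maxent.
apply: (@le_trans _ _ (\sum_i (c i - `|c i| * (k2 * eps)))).
  rewrite sumrB -mulr_suml mulrA lerD2l lerN2 ler_wpM2r //.
  by rewrite /D addrAC lerDr addr_ge0.
apply: ler_sum => i _.
have -> : \sum_j (g i j)%:C *: X j t = (c i)%:C *: N i t.
  by rewrite /N scalerA -rmorphM divff // rmorph1 scale1r.
(* Splitting [N i] as [Y i] plus a remainder gives [c i] from the unit norm of [Y i]; Cauchy-Schwarz
   bounds the rest linearly. *)
rewrite nipZr -[N i t](subrK (Y i t)) nipD.
have YY : nip (Y i t) (Y i t) = 1 by apply: nip_isometry => //; exact: (Yu i t).2.1.
have fY : fnorm (Y i t) = 1.
  by apply/eqP; rewrite -(@eqrXn2 _ 2) ?fnorm_ge0 // expr1n fnorm_sqr YY.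
rewrite YY.
have small : `|nip (Y i t) (N i t - Y i t)| <= k2 * eps.
  apply: le_trans (h2 i t isT).
  rewrite ler_norml -[fnorm _]mul1r -fY nip_cs andbT lerNl.
  rewrite -[- nip _ _]mulN1r -nipZr rmorphN1 scaleN1r.
  by rewrite -[in leRHS](fnormN (_ - _)) nip_cs.
rewrite mulrDr mulr1 addrC lerD2r -mulrN1 -mulrA.
have : - (`|c i| * (k2 * eps)) <= c i * nip (Y i t) (N i t - Y i t).
  rewrite lerNl; apply: le_trans (ler_norm _) _; rewrite normrN normrM.
  by rewrite ler_wpM2l.
by rewrite mulrN1 mulrN.
Qed.
End XorGames.

(* Compactness of the set of Gram matrices of unit vectors *)
From mathcomp Require Import boolp topology normedtype derive.
Import numFieldTopology.Exports numFieldNormedType.Exports.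

Lemma sum_fun_continuous (R : realType) (T : topologicalType) (I : Type) (s : seq I)
    (f : I -> T -> R) :
  (forall i, continuous (f i)) -> continuous (fun x => \sum_(i <- s) f i x).
Proof.
move=> fc x; elim: s => [|i s IH].
  by under eq_fun do rewrite big_nil; exact: cvg_cst.
under eq_fun do rewrite big_cons.
by apply: cvgD; [exact: fc | exact: IH].
Qed.

Section Gram.
Context {R : realType} {N : nat}.
Local Open Scope classical_set_scope.

(** Matrices are flattened to row vectors, for which compactness of boxes and the extreme value
    theorem are applied. *)
Definition pair_form (w : 'I_N -> 'I_N -> R) (v : 'rV[R]_(N * N)) : R :=
  \sum_i \sum_j w i j * v ord0 (mxvec_index i j).

Lemma coord_scale_continuous (e : 'I_(N * N)) (k : R) :
  continuous (fun v : 'rV[R]_(N * N) => k * v ord0 e).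
Proof.
move=> v; have ck : {for v, continuous (fun=> k)} by exact: cst_continuous.
have ce : {for v, continuous (fun v : 'rV[R]_(N * N) => v ord0 e)}.
  exact: coord_continuous.
exact: (continuousM ck ce).
Qed.

Lemma pair_form_continuous w : continuous (pair_form w).
Proof.
apply: sum_fun_continuous => i; apply: sum_fun_continuous => j v.
exact: coord_scale_continuous.
Qed.

Lemma pair_form_closed w : closed [set v : 'rV[R]_(N * N) | 0 <= pair_form w v].
Proof.
apply: (preimage_closed (f := pair_form w) (D := [set x | 0 <= x])).
  by move=> v _; exact: (@pair_form_continuous w v).
exact: closed_ge.
Qed.

Definition gram_set : set 'rV[R]_(N * N) :=
  [set v : 'rV[R]_(N * N) | (forall i, v ord0 (mxvec_index i i) = 1) /\
    (forall i j, v ord0 (mxvec_index i j) = v ord0 (mxvec_index j i)) /\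
    (forall x : 'I_N -> R, 0 <= pair_form (fun i j => x i * x j) v)].

Lemma coord_closed (e e' : 'I_(N * N)) k :
  closed [set v : 'rV[R]_(N * N) | v ord0 e - k * v ord0 e' = 0].
Proof.
apply: (preimage_closed (f := fun v : 'rV[R]_(N * N) => v ord0 e - k * v ord0 e')
  (D := [set x : R | x = 0])); last exact: closed_eq.
move=> v _; have c1 : {for v, continuous (fun v : 'rV[R]_(N * N) => v ord0 e)}.
  exact: coord_continuous.
exact: (continuousB c1 (@coord_scale_continuous e' k v)).
Qed.

Lemma gram_set_closed : closed gram_set.
Proof.
have -> : gram_set =
    \bigcap_(i in [set: 'I_N]) [set v : 'rV[R]_(N * N) | v ord0 (mxvec_index i i) = 1] `&`
    (\bigcap_(ij in [set: 'I_N * 'I_N])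
       [set v : 'rV[R]_(N * N) |
         v ord0 (mxvec_index ij.1 ij.2) - 1 * v ord0 (mxvec_index ij.2 ij.1) = 0] `&`
     \bigcap_(x in [set: 'I_N -> R])
       [set v : 'rV[R]_(N * N) | 0 <= pair_form (fun i j => x i * x j) v]).
  apply/seteqP; split=> v /=.
    move=> [h1 [h2 h3]]; split; first by move=> i _; exact: h1.
    by split=> [ij _|x _]; [rewrite /= (h2 ij.1) mul1r subrr | exact: h3].
  move=> [h1 [h2 h3]]; split; first by move=> i; exact: h1.
  split=> [i j|x]; last exact: h3.
  by have /eqP := h2 (i, j) I; rewrite /= mul1r subr_eq0 => /eqP.
apply: closedI; last apply: closedI.
- apply: closed_bigI => i _.
  apply: (preimage_closed (f := fun v : 'rV[R]_(N * N) => v ord0 (mxvec_index i i))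
    (D := [set x : R | x = 1])); last exact: closed_eq.
  by move=> v _; exact: coord_continuous.
- by apply: closed_bigI => ij _; exact: coord_closed.
- by apply: closed_bigI => x _; exact: pair_form_closed.
Qed.

Lemma sum_delta2 (i j : 'I_N) (s : R) (F : 'I_N -> R) :
  \sum_k ((k == i)%:R + s * (k == j)%:R) * F k = F i + s * F j.
Proof.
under eq_bigr do rewrite mulrDl -mulrA; rewrite big_split /= -mulr_sumr.
have E a : \sum_k (k == a)%:R * F k = F a.
  by rewrite (bigD1 a) //= eqxx mul1r big1 ?addr0 // => k /negbTE ->; rewrite mul0r.
by rewrite !E.
Qed.

(** Positivity at the test vectors [e_i + e_j] and [e_i - e_j] gives [2 + 2 v_ij >= 0] and
    [2 - 2 v_ij >= 0]. *)
Lemma gram_set_le1 v i j : gram_set v -> `|v ord0 (mxvec_index i j)| <= 1.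
Proof.
move=> [h1 [h2 h3]].
have key (s : R) : 0 <= 1 + s * v ord0 (mxvec_index i j) + s * (v ord0 (mxvec_index i j) + s).
  have := h3 (fun k => (k == i)%:R + s * (k == j)%:R); rewrite /pair_form.
  under eq_bigr do under eq_bigr do rewrite -mulrA.
  under eq_bigr do rewrite -mulr_sumr sum_delta2.
  by rewrite sum_delta2 !h1 (h2 j i) mulr1.
by rewrite ler_norml; have := key 1; have := key (-1); lra.
Qed.

Lemma gram_set_compact : compact gram_set.
Proof.
apply: (subclosed_compact gram_set_closed (rV_compact (A := fun=> `[(- 1 : R), 1]) _)).
  by move=> _; exact: segment_compact.
move=> v vG e /=; case: (mxvec_indexP e) => i j.
by rewrite in_itv /= -ler_norml; exact: gram_set_le1.
Qed.

Lemma gram_set_max (w : 'I_N -> 'I_N -> R) :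
  exists2 v, gram_set v & forall v', gram_set v' -> pair_form w v' <= pair_form w v.
Proof.
have G0 : gram_set !=set0.
  exists (mxvec 1%:M); split; first by move=> i; rewrite mxvecE mxE eqxx.
  split=> [i j|x]; first by rewrite !mxvecE !mxE eq_sym.
  rewrite /pair_form; apply: sumr_ge0 => i _; apply: sumr_ge0 => j _.
  rewrite mxvecE mxE; case: eqP => [->|_]; last by rewrite mulr0.
  by rewrite mulr1 -expr2 sqr_ge0.
have [v /set_mem vG vmax] := EVT_max_rV G0 gram_set_compact
  (continuous_subspaceT (pair_form_continuous (w := w))).
by exists v => // v' v'G; apply: vmax; exact: mem_set.
Qed.

(** Diagonalise [G] over the complex numbers and scale by the square roots of the eigenvalues. The
    real and imaginary parts of the eigenvectors become separate real coordinates, hence the index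
    type [bool * 'I_N]. *)
Lemma gram_vectors (G : 'I_N -> 'I_N -> R) :
  (forall i j, G i j = G j i) ->
  (forall x : 'I_N -> R, 0 <= \sum_i \sum_j x i * x j * G i j) ->
  exists u : 'I_N -> bool * 'I_N -> R, forall i j, \sum_k u i k * u j k = G i j.
Proof.
move=> Gsym Gpsd.
pose H : 'M[R[i]]_N := \matrix_(i, j) (G i j)%:C.
have Ha : adjmx H = H by apply/matrixP => i j; rewrite !mxE conjc_real Gsym.
pose U := spectralmx H; pose l := eigval H.
have HE : H = adjmx U *m rdiag l *m U by rewrite -[LHS](fcalc_id Ha).
have UH : U *m H *m adjmx U = rdiag l.
  rewrite HE !mulmxA spectralmx_mulr mul1mx -mulmxA spectralmx_mulr mulmx1 //.
pose a k i := complex.Re (U k i); pose b k i := complex.Im (U k i).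
(* For real symmetric [G], the form at a complex vector is the sum of its values at the real and
   imaginary parts. *)
have l_ge0 k : 0 <= l k.
  have -> : l k = complex.Re ((U *m H *m adjmx U) k k) by rewrite UH !mxE eqxx mulr1n.
  have -> : complex.Re ((U *m H *m adjmx U) k k) =
      \sum_i \sum_j a k i * a k j * G i j + \sum_i \sum_j b k i * b k j * G i j.
    rewrite mxE Re_sum exchange_big [X in _ + X]exchange_big -big_split /=.
    apply: eq_bigr => j _; rewrite mxE mulr_suml Re_sum -big_split /=.
    apply: eq_bigr => i _; rewrite adjmxE mxE /a /b.
    by case: (U k i) (U k j) => [x y] [z t] /=; ring.
  by rewrite addr_ge0.
exists (fun i bk => Num.sqrt (l bk.2) * (if bk.1 then a bk.2 i else b bk.2 i)) => i j.
pose F c k := Num.sqrt (l k) * (if c then a k i else b k i) *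
  (Num.sqrt (l k) * (if c then a k j else b k j)).
transitivity (\sum_(c : bool) \sum_k F c k); first by rewrite pair_bigA.
rewrite big_bool /F /= -big_split /=.
have -> : G i j = complex.Re (H i j) by rewrite mxE.
rewrite HE mxE Re_sum; apply: eq_bigr => k _.
rewrite mul_mx_diag !mxE -/U.
have -> : Num.sqrt (l k) * a k i * (Num.sqrt (l k) * a k j) +
    Num.sqrt (l k) * b k i * (Num.sqrt (l k) * b k j) =
    Num.sqrt (l k) ^+ 2 * (a k i * a k j + b k i * b k j) by ring.
rewrite sqr_sqrtr // /a /b.
by case: (U k i) (U k j) => [x y] [z t] /=; ring.
Qed.
End Gram.

(** * Clifford generators and strategies from unit vectors *)

Section Clifford.
Context {R : realType}.
Local Notation C := (R[i]).

(** Doubling the dimension, the old generators become [Gam b] and [- Gam b] on the two diagonal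
    blocks, and the swap of the blocks is a new involution anticommuting with all of them. *)
Lemma clifford_generators p : exists (k : nat) (Gam : 'I_p -> 'M[C]_k), (0 < k)%N /\
  (forall a, adjmx (Gam a) = Gam a) /\
  (forall a b, Gam a *m Gam b + Gam b *m Gam a = (if a == b then 2%:R else 0)%:M).
Proof.
elim: p => [|p [k [Gam [k0 [Ga Gac]]]]].
  (* Dimension 1 rather than 0, so that a maximally entangled unit vector exists. *)
  by exists 1%N, (fun=> 0); split=> //; split; case.
exists (k + k)%N, (fun a => if unlift ord0 a is Some b
  then block_mx (Gam b) 0 0 (- Gam b) else block_mx 0 1%:M 1%:M 0).
have adjb (A B E D : 'M[C]_k) : adjmx (block_mx A B E D) =
    block_mx (adjmx A) (adjmx E) (adjmx B) (adjmx D).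
  by rewrite /adjmx /entconjmx map_block_mx tr_block_mx.
split; first by rewrite addn_gt0 k0.
split=> [a|a b].
  by case: (unliftP ord0 a) => [c|] _; rewrite adjb adjmx0 ?adjmxN ?Ga ?adjmx1.
case: (unliftP ord0 a) => [c|] ->; case: (unliftP ord0 b) => [e|] ->;
  rewrite ?liftK ?unlift_none !mulmx_block add_block_mx
    !(mulmx0, mul0mx, addr0, add0r, mul1mx, mulmx1, mulmxN, mulNmx, opprK).
- by rewrite Gac (inj_eq (@lift_inj _ _)) -scalar_mx_block.
- by rewrite subrr addNr eq_sym (negbTE (neq_lift _ _)) block_mx0 raddf0.
- by rewrite subrr addNr (negbTE (neq_lift _ _)) block_mx0 raddf0.
- by rewrite eqxx -raddfD -scalar_mx_block.
Qed.

Definition clifford_comb {E : finType} {k} (Gam : E -> 'M[C]_k) (u : E -> R) : 'M[C]_k :=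
  \sum_e (u e)%:C *: Gam e.

Lemma clifford_combM (E : finType) k (Gam : E -> 'M[C]_k) (u v : E -> R) :
  (forall a b, Gam a *m Gam b + Gam b *m Gam a = (if a == b then 2%:R else 0)%:M) ->
  clifford_comb Gam u *m clifford_comb Gam v + clifford_comb Gam v *m clifford_comb Gam u =
  (2 * \sum_e u e * v e)%:C *: 1%:M.
Proof.
move=> Gac; pose cross a b := (u a * v b)%:C *: (Gam a *m Gam b + Gam b *m Gam a).
transitivity (\sum_a \sum_b cross a b).
  rewrite /clifford_comb mulmx_suml [X in _ + X]mulmx_sumr -big_split; apply: eq_bigr => a _ /=.
  rewrite mulmx_sumr mulmx_suml -big_split; apply: eq_bigr => b _ /=.
  rewrite /cross -!scalemxAl -!scalemxAr !scalerA scalerDr !rmorphM.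
  by rewrite [(v b)%:C * _]mulrC.
rewrite mulr_sumr rmorph_sum scaler_suml; apply: eq_bigr => a _.
rewrite (bigD1 a) //= big1 ?addr0 => [|b ba].
  rewrite /cross Gac eqxx scale_scalar_mx scalemx1.
  by congr (_%:M); rewrite [(2 * _)%:C]rmorphM mulrC rmorph_nat.
by rewrite /cross Gac eq_sym (negbTE ba) scale_scalar_mx mulr0 raddf0.
Qed.

(** Clifford combinations of unit vectors are self-adjoint unitaries, and their correlation in the
    maximally entangled state is the inner product of the vectors. *)
Lemma clifford_strategy (m n : nat) (E : finType) (u : 'I_m -> E -> R) (v : 'I_n -> E -> R) :
  (forall i, \sum_e u i e * u i e = 1) -> (forall j, \sum_e v j e * v j e = 1) ->
  exists k (Y : 'I_m -> 'M[C]_k) (X : 'I_n -> 'M[C]_k) psi,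
    is_xor_strategy Y X psi /\
    forall g, xor_bias g Y X psi = \sum_i \sum_j g i j * \sum_e u i e * v j e.
Proof.
move=> u1 v1; have [k [Gam0 [k0 [Ga0 Gac0]]]] := clifford_generators #|E|.
pose Gam e := Gam0 (enum_rank e).
have Ga e : adjmx (Gam e) = Gam e by exact: Ga0.
have Gac a b : Gam a *m Gam b + Gam b *m Gam a = (if a == b then 2%:R else 0)%:M.
  by rewrite Gac0 (inj_eq enum_rank_inj).
have combu w : \sum_e w e * w e = 1 -> is_sa_unitary (clifford_comb Gam w).
  move=> w1; have wa : adjmx (clifford_comb Gam w) = clifford_comb Gam w.
    by rewrite adjmx_sum; apply: eq_bigr => e _; rewrite adjmxZ Ga.
  suff ww : clifford_comb Gam w *m clifford_comb Gam w = 1%:M by rewrite /is_sa_unitary wa.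
  have := clifford_combM w w Gac; rewrite w1 mulr1 -mulr2n -scaler_nat rmorph_nat.
  by apply: scalerI; rewrite pnatr_eq0.
have combn w z : nip (clifford_comb Gam w) (clifford_comb Gam z) = \sum_e w e * z e.
  have wa y : adjmx (clifford_comb Gam y) = clifford_comb Gam y.
    by rewrite adjmx_sum; apply: eq_bigr => e _; rewrite adjmxZ Ga.
  have E1 (A B : 'M[C]_k) : adjmx A = A -> nip A B = nip 1%:M (A *m B).
    by move=> Aa; rewrite !nipE -{1}[A]mulmx1 hsip_mull Aa.
  (* Only the anticommutator is known; symmetry of [nip] makes each single term half of its
     trace. *)
  have : nip (clifford_comb Gam w) (clifford_comb Gam z) +
         nip (clifford_comb Gam z) (clifford_comb Gam w) = 2 * \sum_e w e * z e.
    by rewrite (E1 _ _ (wa w)) (E1 _ _ (wa z)) -nipD clifford_combM // nipZr nip11 // mulr1.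
  by rewrite [X in _ + X]nip_sym; lra.
exists k, (fun i => entconjmx (clifford_comb Gam (u i))), (fun j => clifford_comb Gam (v j)),
  (maxent k); split.
  split=> [i|]; first exact/entconjmx_sa_unitary/combu.
  by split=> [j|]; [exact: combu | exact: vnorm_maxent].
move=> g; rewrite xor_bias_maxent; apply: eq_bigr => i _.
by rewrite nip_sumr; apply: eq_bigr => j _; rewrite nipZr combn.
Qed.
End Clifford.

(** * Existence of an optimal XOR strategy *)

Section Tsirelson.
Context {R : realType} {m n : nat}.
Local Notation C := (R[i]).
Local Notation Re := (@complex.Re R).

(** Weights are placed on one off-diagonal block only, so each pair of an Alice and a Bob vector
    counts once. *)
Definition cross_weight (g : 'I_m -> 'I_n -> R) (p q : 'I_(m + n)) : R :=
  match split p, split q with inl i, inr j => g i j | _, _ => 0 end.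

Lemma split_lshift a b (i : 'I_a) : split (lshift b i) = inl i.
Proof. exact: (unsplitK (inl i)). Qed.

Lemma split_rshift a b (j : 'I_b) : split (rshift a j) = inr j.
Proof. exact: (unsplitK (inr j)). Qed.

Lemma pair_form_cross g (v : 'rV[R]_((m + n) * (m + n))) :
  pair_form (cross_weight g) v =
  \sum_i \sum_j g i j * v ord0 (mxvec_index (lshift n i) (rshift m j)).
Proof.
rewrite /pair_form big_split_ord /= [X in _ + X]big1 => [|p _]; last first.
  by rewrite big1 // => q _; rewrite /cross_weight split_rshift mul0r.
rewrite addr0; apply: eq_bigr => i _; rewrite big_split_ord /= big1 => [|q _].
  by rewrite add0r; apply: eq_bigr => j _; rewrite /cross_weight split_lshift split_rshift.
by rewrite /cross_weight !split_lshift mul0r.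
Qed.

(** The Gram matrix is that of the unit vectors obtained by applying each observable, on its own
    tensor factor, to the state. *)
Lemma strategy_gram k (Y : 'I_m -> 'M[C]_k) (X : 'I_n -> 'M[C]_k) psi :
  is_xor_strategy Y X psi ->
  exists2 v, gram_set v & forall g, xor_bias g Y X psi = pair_form (cross_weight g) v.
Proof.
move=> [Yu [Xu psi1]].
pose w (p : 'I_(m + n)) : 'cV[C]_(k * k) := match split p with
  | inl i => tensmx (Y i) 1%:M *m psi | inr j => tensmx 1%:M (X j) *m psi end.
have psi_hs : hsip psi psi = 1.
  by rewrite -hsnorm_sqr -vnormE psi1 expr1n.
exists (mxvec (\matrix_(p, q) hsip (w p) (w q))).
  split=> [p|]; last split=> [p q|x].
  - rewrite mxvecE mxE /w; case: (split p) => i;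
      rewrite hsip_mull adjmx_tens mulmxA tensmx_mul adjmx1 mulmx1.
      by have [_ [-> _]] := Yu i; rewrite tensmx1 mul1mx.
    by have [_ [-> _]] := Xu i; rewrite tensmx1 mul1mx.
  - by rewrite !mxvecE !mxE hsip_sym.
  - rewrite /pair_form; apply: le_trans (hsip_ge0 (\sum_p (x p)%:C *: w p)) _.
    rewrite hsip_suml le_eqVlt; apply/orP; left; apply/eqP; apply: eq_bigr => p _.
    rewrite hsip_sumr; apply: eq_bigr => q _.
    by rewrite hsipZl hsipZr mxvecE mxE mulrA.
move=> g; rewrite pair_form_cross /xor_bias Re_sum; apply: eq_bigr => i _.
rewrite Re_sum; apply: eq_bigr => j _; rewrite Re_scale; congr (_ * _).
rewrite mxvecE mxE /w split_lshift split_rshift hsip_mull adjmx_tens mulmxA tensmx_mul.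
by rewrite adjmx1 mulmx1 mul1mx (Yu i).1 hsip_cV mulmxA.
Qed.

Theorem xor_optimal_strategy (g : 'I_m -> 'I_n -> R) :
  exists k (Y : 'I_m -> 'M[C]_k) (X : 'I_n -> 'M[C]_k) psi,
    is_xor_strategy Y X psi /\ xor_bias g Y X psi = xor_opt_bias g.
Proof.
have [v vG vmax] := gram_set_max (cross_weight g).
have [v1 [vsym vpsd]] := vG.
have [||u uE] := gram_vectors (G := fun p q => v ord0 (mxvec_index p q)).
- by move=> p q; exact: vsym.
- exact: vpsd.
have [||k [Y [X [psi [strat biasE]]]]] := clifford_strategy
    (u := fun i => u (lshift n i)) (v := fun j => u (rshift m j)).
- by move=> i; rewrite uE v1.
- by move=> j; rewrite uE v1.
exists k, Y, X, psi; split=> //.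
have opt : xor_bias g Y X psi = pair_form (cross_weight g) v.
  rewrite biasE pair_form_cross; apply: eq_bigr => i _; apply: eq_bigr => j _.
  by rewrite uE.
(* Every strategy yields a point of [gram_set], on which the realised value is maximal; so the
   supremum is attained. *)
have ub : ubound [set b : R | exists k (Y : 'I_m -> 'M[C]_k) (X : 'I_n -> 'M[C]_k) psi,
    is_xor_strategy Y X psi /\ b = xor_bias g Y X psi]%classic (xor_bias g Y X psi).
  move=> _ [k' [Y' [X' [psi' [strat' ->]]]]].
  by have [v' v'G ->] := strategy_gram strat'; rewrite opt; exact: vmax.
apply/eqP; rewrite eq_le; apply/andP; split.
  by apply: ub_le_sup; [exists (xor_bias g Y X psi) | exists k, Y, X, psi].
by apply: ge_sup => //; exists (xor_bias g Y X psi), k, Y, X, psi.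
Qed.

(** The hypothesis speaks only about optimal strategies, so one must exist; its row contributions
    are the [c i]. *)
Lemma sum_marginal_row_biases (g : 'I_m -> 'I_n -> R) (c : 'I_m -> R) :
  is_marginal_row_biases g c -> \sum_i c i = xor_opt_bias g.
Proof.
move=> gc; have [k [Y [X [psi [strat opt]]]]] := xor_optimal_strategy g.
rewrite -[RHS]opt /xor_bias Re_sum; apply: eq_bigr => i _.
by have [_ <-] := gc k Y X psi strat opt i.
Qed.
End Tsirelson.

Unset Implicit Arguments.
Local Close Scope complex_scope.

Theorem theorem1p2 (R : realType) :
  (* 1. synchronous games *)
  (forall (I A : finType) (eta : I -> I -> R) (V : A -> A -> I -> I -> bool),
    is_sync_game eta V ->
    forall K : R, 0 < K ->
    exists (C eps0 : R), 0 < C /\ 0 < eps0 /\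
    forall (eps : R) (d : nat), 0 <= eps -> eps <= eps0 -> (0 < d)%N ->
    forall phi : (I * A)%type -> 'M[R[i]]_d,
      eps_rep (sync_rel V) (@fnorm R d) phi eps ->
      (forall i a, opnorm (phi (i, a)) <= K) ->
      exists Q : I -> A -> 'M[R[i]]_d,
        (forall i, is_pvm (Q i)) /\
        (forall i a, fnorm (Q i a - phi (i, a)) <= C * eps) /\
        1 - C * eps ^+ 2 <= win_prob eta V (fun i a => entconjmx (Q i a)) Q (@maxent R d))
  /\
  (* 2. BCS games *)
  (forall (n m : nat) (K : 'I_m -> {set 'I_n})
          (sat : 'I_m -> {ffun 'I_n -> bool} -> bool) (eta : 'I_m -> 'I_n -> R),
    is_distr eta ->
    forall Kb : R, 0 < Kb ->
    exists (C eps0 : R), 0 < C /\ 0 < eps0 /\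
    forall (eps : R) (d : nat), 0 <= eps -> eps <= eps0 -> (0 < d)%N ->
    forall phi : 'I_n -> 'M[R[i]]_d,
      eps_rep (bcs_rel K sat) (@fnorm R d) phi eps ->
      (forall j, opnorm (phi j) <= Kb) ->
      exists (Y : 'I_m -> 'I_n -> 'M[R[i]]_d) (X : 'I_n -> 'M[R[i]]_d),
        is_bcs_strategy K sat Y X (@maxent R d) /\
        (forall j, fnorm (X j - phi j) <= C * eps) /\
        1 - C * eps ^+ 2 <= bcs_win_prob eta K Y X (@maxent R d))
  /\
  (* 3. XOR games *)
  (forall (m n : nat) (t : 'I_m -> 'I_n -> bool) (pi : 'I_m -> 'I_n -> R),
    is_distr pi ->
    forall c : 'I_m -> R,
    is_marginal_row_biases (xor_cost t pi) c ->
    (forall i, c i != 0) ->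
    forall K : R, 0 < K ->
    exists (C eps0 : R), 0 < C /\ 0 < eps0 /\
    forall (eps : R) (d : nat), 0 <= eps -> eps <= eps0 -> (0 < d)%N ->
    forall phi : 'I_n -> 'M[R[i]]_d,
      eps_rep (xor_rel (xor_cost t pi) c) (@fnorm R d) phi eps ->
      (forall j, opnorm (phi j) <= K) ->
      exists (Y : 'I_m -> 'M[R[i]]_d) (X : 'I_n -> 'M[R[i]]_d),
        is_xor_strategy Y X (@maxent R d) /\
        (forall j, fnorm (X j - phi j) <= C * eps) /\
        xor_opt_bias (xor_cost t pi) - C * eps <= xor_bias (xor_cost t pi) Y X (@maxent R d)).
Proof.
split; last split.
- by move=> I A eta V game K _; exact: sync_stability game.
- by move=> n m K sat eta eta_distr Kb _; exact: bcs_stability eta_distr.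
- move=> m n t pi _ c marginal c0 K _.
  by rewrite -(sum_marginal_row_biases marginal); exact: xor_stability c0.
Qed.
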